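(* Let $\mathbf e\in\mathbb Z^m$ with $\gcd(e_1,\dots,e_m,r)=1$, let $\underline{\mathbf w}$ be a $\mathbb Z$-basis of $L$, let $c$ be a positive integer, and let $n\ge m$ be an integer coprime with $r$. With the notation of the context, the code $\mathbb F_{q^n}\otimes_{\mathbb F_q}\mathrm{LRM}(\mathbf e;\,cS_{\underline{\mathbf w}})$ is isomorphic to a subcode of $\mathrm{LAG}\big(P(Y);\,q^{m-1}rc;\,I\big)$. Moreover the isomorphism is explicit and it preserves the sum-rank distance.
   Context: **LRM codes.** $\mathbb F_q$ is a finite field with $q$ elements, $\mathbb F_{q^r}$ its extension of degree $r\ge1$, $\Phi:x\mapsto x^q$, $m\ge1$. The ring $\mathbb F_{q^r}[\mathbf X^{\pm1};\boldsymbol\theta]$ consists of finite sums $\sum_{\mathbf u\in\mathbb Z^m}a_{\mathbf u}\mathbf X^{\mathbf u}$ ($a_{\mathbf u}\in\mathbb F_{q^r}$), where the variables commute with each other and $\mathbf X^{\mathbf u}\cdot a=\Phi^{\mathbf e\cdot\mathbf u}(a)\mathbf X^{\mathbf u}$ for $a\in\mathbb F_{q^r}$. Let $L=\{\mathbf u\in\mathbb Z^m:\mathbf e\cdot\mathbf u\in r\mathbb Z\}$, with fixed basis $\underline{\mathbf w}=(\mathbf w_1,\dots,\mathbf w_m)$, and let $H$ be the set of group homomorphisms $L\to\mathbb F_q^\times$. For each $\gamma\in H$ fix $\tilde\gamma:\mathbb Z^m\to\mathbb F_{q^r}^\times$ extending $\gamma$ with $\tilde\gamma(\mathbf u+\mathbf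 v)=\tilde\gamma(\mathbf u)\Phi^{\mathbf e\cdot\mathbf u}(\tilde\gamma(\mathbf v))$ for all $\mathbf u,\mathbf v\in\mathbb Z^m$ (this is possible), and let $\epsilon_{\tilde\gamma}:\mathbb F_{q^r}[\mathbf X^{\pm1};\boldsymbol\theta]\to\operatorname{End}_{\mathbb F_q}(\mathbb F_{q^r})$ be the ring homomorphism $\sum a_{\mathbf u}\mathbf X^{\mathbf u}\mapsto\sum a_{\mathbf u}\tilde\gamma(\mathbf u)\Phi^{\mathbf e\cdot\mathbf u}$. Put $\epsilon=(\epsilon_{\tilde\gamma})_{\gamma\in H}$. Let $cS_{\underline{\mathbf w}}=\{\sum\lambda_i\mathbf w_i:\lambda_i\in\mathbb R_{\ge0},\ \sum\lambda_i\le c\}$. Then $\mathrm{LRM}(\mathbf e;cS_{\underline{\mathbf w}})\subset\prod_{\gamma\in H}\operatorname{End}_{\mathbb F_q}(\mathbb F_{q^r})$ is the image under $\epsilon$ of the $\mathbb F_{q^r}$-span of the $\mathbf X^{\mathbf u}$, $\mathbf u\in cS_{\underline{\mathbf w}}\cap\mathbb Z^m$. Since $\gcd(n,r)=1$, $\mathbb F_{q^n}\otimes_{\mathbb F_q}\mathbb F_{q^r}\simeq\mathbb F_{q^{nr}}$, hence $\mathbb F_{q^n}\otimes_{\mathbb F_q}\operatorname{End}_{\mathbb F_q}(\mathbb F_{q^r})\simeq\operatorname{End}_{\mathbb F_{q^n}}(\mathbb F_{q^{nr}})$; thus $\mathbb F_{q^n}\otimes_{\mathbb F_q}\mathrm{LRM}(\mathbf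 e;cS_{\underline{\mathbf w}})$ is viewed inside $\prod_{\gamma\in H}\operatorname{End}_{\mathbb F_{q^n}}(\mathbb F_{q^{nr}})$. The sum-rank weight of a tuple of elements of $\operatorname{End}_{\mathbb F_{q^n}}(\mathbb F_{q^{nr}})$ is the sum of their $\mathbb F_{q^n}$-ranks, and the sum-rank distance is the weight of the difference. **Auxiliary data.** Fix an $\mathbb F_q$-basis $(b_1,\dots,b_n)$ of $\mathbb F_{q^n}$, and let $\beta_i:\mathbb F_{q^n}\to\mathbb F_q$, $y\mapsto\operatorname{Tr}_{\mathbb F_{q^n}/\mathbb F_q}(b_iy)$. Let $E=\bigcap_{j>m}\ker\beta_j$; then $\beta_{\le m}=(\beta_1,\dots,\beta_m)$ restricts to an isomorphism $E\to\mathbb F_q^m$, and $\beta_{\le m}^{-1}$ denotes its inverse. For $1\le i\le m$ let $B_i(Y)\in\mathbb F_{q^n}[Y]$ be the polynomial of degree at most $q^{m-1}$ with $B_i(y)=\beta_i(y)$ for all $y\in E$ (it exists and is unique). Choose $\mathbf v\in\mathbb Z^m$ with $\mathbf e\cdot\mathbf v\equiv1\pmod r$, write $r\mathbf v=\mu_1\mathbf w_1+\cdots+\mu_m\mathbf w_m$ with $\mu_i\in\mathbb Z$, and set $P(Y)=B_1(Y)^{\mu_1}\cdots B_m(Y)^{\mu_m}\in\mathbb F_{q^n}[Y]$. Let $I=\beta_{\le m}^{-1}\big((\mathbb F_q^\times)^m\big)\subset E$; the map $\gamma\mapsto\beta_{\le m}^{-1}(\gamma(\mathbf w_1),\dots,\gamma(\mathbf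 w_m))$ is a bijection $H\to I$, and $P(y)\ne0$ for $y\in I$. **LAG codes.** Let $\theta$ be the automorphism of $\mathbb F_{q^{nr}}$ that is the identity on $\mathbb F_{q^n}$ and $x\mapsto x^q$ on $\mathbb F_{q^r}$, extended to $\mathbb F_{q^{nr}}(Y)$ by $\theta(Y)=Y$. Let $D_P=\mathbb F_{q^{nr}}(Y)[T;\theta]/(T^r-P(Y))$, where $Ta=\theta(a)T$. For an integer $N\ge0$, $\Lambda_P(N)\subset D_P$ is the $\mathbb F_{q^{nr}}$-subspace of elements $\sum_{i=0}^{r-1}\frac{u_i(Y)}{v_i(Y)}T^i$ with $u_i,v_i\in\mathbb F_{q^{nr}}[Y]$ such that, for all $i$: $\gcd(u_i,v_i)=1$; $r(\deg u_i-\deg v_i)+i\deg P\le N$; and $v_i^r$ divides $P^i$. The union $\Lambda_P=\bigcup_N\Lambda_P(N)$ is a subalgebra of $D_P$. For each $y\in\mathbb F_{q^n}$ with $P(y)\ne0$ there is an isomorphism of $\mathbb F_{q^n}$-algebras $\Lambda_P/(Y-y)\Lambda_P\simeq\operatorname{End}_{\mathbb F_{q^n}}(\mathbb F_{q^{nr}})$; fix one for each $y\in I$ and let $\eta_y:\Lambda_P\to\operatorname{End}_{\mathbb F_{q^n}}(\mathbb F_{q^{nr}})$ be the induced map. Then $\mathrm{LAG}(P(Y);N;I)=\{(\eta_y(f))_{y\in I}:f\in\Lambda_P(N)\}\subset\prod_{y\in I}\operatorname{End}_{\mathbb F_{q^n}}(\mathbb F_{q^{nr}})$. *)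

(* Defs.v *)
From HB Require Import structures.
From mathcomp Require Import all_boot all_order all_algebra all_fingroup all_field.
From mathcomp Require Import finmap generic_quotient.
From mathcomp Require Import boolp classical_sets functions fsbigop reals.

Set Implicit Arguments.
Unset Strict Implicit.
Unset Printing Implicit Defensive.

Import Order.TTheory GRing.Theory Num.Theory.

Local Open Scope ring_scope.
Local Open Scope classical_set_scope.

Section Lattice.
Variables (m r : nat) (e : 'rV[int]_m).

Definition dotz (u v : 'rV[int]_m) : int := \sum_(i < m) u 0 i * v 0 i.

Definition in_lat : {pred 'rV[int]_m} := [pred u | (r%:Z %| dotz e u)%Z].

Fact in_lat_zmod_closed : zmod_closed in_lat.
Proof.
split=> [|u v].
  by rewrite inE /dotz big1 ?dvdz0// => i _; rewrite mxE mulr0.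
rewrite !inE => hu hv; suff -> : dotz e (u - v) = dotz e u - dotz e v.
  by case: (dvdz_zmod_closed r%:Z) => _; apply.
by rewrite /dotz -sumrB; apply: eq_bigr => i _; rewrite !mxE mulrBr.
Qed.

HB.instance Definition _ :=
  GRing.isZmodClosed.Build 'rV[int]_m in_lat in_lat_zmod_closed.

Record lattice := Lattice { lat_val :> 'rV[int]_m; _ : lat_val \in in_lat }.

HB.instance Definition _ := [isSub for lat_val].
HB.instance Definition _ := [Choice of lattice by <:].
HB.instance Definition _ := [SubChoice_isSubZmodule of lattice by <:].

Definition Zbasis (w : 'I_m -> lattice) : Prop :=
  forall u : lattice, exists! l : {ffun 'I_m -> int}, u = \sum_i w i *~ l i.

Definition simplex (R : realType) (w : 'I_m -> lattice) (c : nat)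
    : set 'rV[int]_m :=
  [set u | exists l : 'I_m -> R,
     [/\ forall i, 0 <= l i, \sum_i l i <= c%:R &
         map_mx intr u = \sum_i l i *: map_mx intr (lat_val (w i))]].

End Lattice.

Record lat_hom (F : finFieldType) m r (e : 'rV[int]_m) := LatHom {
  lat_hom_fun :> lattice r e -> {unit F};
  lat_homD : forall u v : lattice r e,
    lat_hom_fun (u + v) = (lat_hom_fun u * lat_hom_fun v)%g }.

(* The sum runs over a classical set; it is the usual sum as soon as J is
   finite, and 0 by convention if infinitely many ranks are nonzero. *)
Definition sumrank_weight (K : fieldType) (V : vectType K) (J : Type)
    (f : J -> 'End(V)) : nat :=
  \big[addn/0%N]_(j \in [set: {classic J}]) \dim (limg (f j)).

Definition sumrank_dist (K : fieldType) (V : vectType K) (J : Type)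
    (f g : J -> 'End(V)) : nat :=
  sumrank_weight (f - g).

Definition linear_on (K : fieldType) (V W : lmodType K) (C : set V)
    (psi : V -> W) : Prop :=
  forall (a : K) (f g : V), C f -> C g ->
    psi (a *: f + g) = a *: psi f + psi g.

Definition subspace (K : fieldType) (V : lmodType K) (C : set V) : Prop :=
  C 0 /\ forall (a : K) (f g : V), C f -> C g -> C (a *: f + g).

Section LRM.
Variables (F : finFieldType) (Fr : fieldExtType F).
Variables (m r : nat) (e : 'rV[int]_m).

(* The k-th power of the Frobenius x |-> x ^ q.  The latter has order r on a
   field with q ^ r elements, so reducing k modulo r covers negative powers. *)
Definition Frob (k : int) (x : Fr) : Fr := x ^+ (#|F| ^ `|(k %% r%:Z)%Z|%N)%N.

Definition twisted_ext (gam : lat_hom F r e) (tg : 'rV[int]_m -> Fr) : Prop :=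
  [/\ forall u, tg u != 0,
      forall u : lattice r e, tg (lat_val u) = (FinRing.uval (gam u))%:A &
      forall u v, tg (u + v) = tg u * Frob (dotz e u) (tg v)].

(* f represents the skew Laurent polynomial \sum_u f u X^u. *)
Definition laurent := {fsfun 'rV[int]_m -> Fr with 0}.

Definition laurent_monom (a : Fr) (u : 'rV[int]_m) : laurent :=
  [fsfun z in [fset u]%fset => a | 0].

Definition eval_laurent (tg : 'rV[int]_m -> Fr) (f : laurent) : 'End(Fr) :=
  linfun (fun x : Fr =>
    \sum_(u <- finsupp f) f u * tg u * Frob (dotz e u) x).

Definition LRM (tgam : lat_hom F r e -> 'rV[int]_m -> Fr)
    (S : set 'rV[int]_m) : set (lat_hom F r e -> 'End(Fr)) :=
  [set C | exists f : laurent, (forall u, f u != 0 -> S u) /\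
           C = (fun gam => eval_laurent (tgam gam) f)].

End LRM.

Section BaseChange.
Variables (F : finFieldType) (Fr : fieldExtType F) (Fn : splittingFieldType F).
Variables (Fnr : fieldExtType Fn) (iota : Fr -> Fnr).

(* g is the image of 1 (x) f under the isomorphism between
   Fn (x)_F End_F(Fr) and End_Fn(Fnr). *)
Definition extends (f : 'End(Fr)) (g : 'End(Fnr)) : Prop :=
  forall x, g (iota x) = iota (f x).

Definition base_change (J : Type) (C : set (J -> 'End(Fr)))
    : set (J -> 'End(Fnr)) :=
  [set D | exists (k : nat) (a : 'I_k -> Fn) (f : 'I_k -> J -> 'End(Fr))
                  (g : 'I_k -> J -> 'End(Fnr)),
     [/\ forall l, C (f l), forall l j, extends (f l j) (g l j) &
         D = \sum_(l < k) a l *: g l]].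

End BaseChange.

Section Traces.
Variables (F : finFieldType) (Fn : splittingFieldType F).
Variables (m n : nat) (b : n.-tuple Fn).

(* Indices start at 0.  Values are in Fn, in the image of F. *)
Definition beta (i : nat) (y : Fn) : Fn := galTrace 1 {:Fn} (b`_i * y).

Definition Eset : set Fn :=
  [set y | forall j, (m <= j < n)%N -> beta j y = 0].

Definition Iset : set Fn :=
  [set y | Eset y /\ forall j, (j < m)%N -> beta j y != 0].

End Traces.

Notation "x %:F" := (FracField.tofrac x) : ring_scope.

Definition frac_map (K : fieldType) (f : {poly K} -> {poly K})
    (x : {fraction {poly K}}) : {fraction {poly K}} :=
  (f \n_(repr x))%:F / (f \d_(repr x))%:F.

Definition ext_poly (Fn : fieldType) (Fnr : fieldExtType Fn) (p : {poly Fn}) :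
  {poly Fnr} := map_poly (in_alg Fnr) p.
Arguments ext_poly {Fn} Fnr p.

Section LAG.
Variables (Fn : fieldType) (Fnr : fieldExtType Fn).
Variables (r : nat) (theta : 'AEnd(Fnr)) (P : {poly Fn}).

(* d represents \sum_(i < r) d i T^i in Fnr(Y)[T; theta] / (T^r - P). *)
Definition DP := {ffun 'I_r -> {fraction {poly Fnr}}}.

Definition DP_monom (i : 'I_r) (s : {fraction {poly Fnr}}) : DP :=
  [ffun k => if k == i then s else 0].

Definition DP_one : DP := [ffun k : 'I_r => ((k : nat) == 0)%:R].

Definition DP_scale (s : {fraction {poly Fnr}}) (d : DP) : DP :=
  [ffun k => s * d k].

Definition theta_frac : {fraction {poly Fnr}} -> {fraction {poly Fnr}} :=
  frac_map (map_poly theta).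

Definition DP_mul (d d' : DP) : DP :=
  [ffun k : 'I_r => \sum_(i < r) \sum_(j < r)
     (if (i + j)%N == k then d i * iter i theta_frac (d' j)
      else if (i + j)%N == (k + r)%N
           then d i * iter i theta_frac (d' j) * (ext_poly Fnr P)%:F
      else 0)].

Definition Lambda (N : nat) : set DP :=
  [set d | forall i : 'I_r, exists u v : {poly Fnr},
     [/\ v != 0, d i = u%:F / v%:F, coprimep u v,
         u != 0 -> r%:Z * ((size u).-1%:Z - (size v).-1%:Z)
                     + i%:Z * (size P).-1%:Z <= N%:Z &
         v ^+ r %| ext_poly Fnr P ^+ i]].

Definition LambdaU : set DP := [set d | exists N, Lambda N d].

(* eta is the composite of the quotient map Lambda -> Lambda / (Y - y) Lambda
   with an isomorphism of Fn-algebras onto End_Fn(Fnr). *)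
Definition quotient_map (y : Fn) (eta : DP -> 'End(Fnr)) : Prop :=
  [/\ forall (a : Fn) d d', LambdaU d -> LambdaU d' ->
        eta (DP_scale (a%:A)%:P%:F d + d') = a *: eta d + eta d',
      forall d d', LambdaU d -> LambdaU d' ->
        eta (DP_mul d d') = (eta d \o eta d')%VF,
      eta DP_one = \1%VF,
      forall g, exists2 d, LambdaU d & eta d = g &
      forall d, LambdaU d -> (eta d = 0 <->
        exists2 d', LambdaU d' & d = DP_scale ('X - (y%:A)%:P)%:F d')].

Definition LAG (N : nat) (I : set Fn) (eta : Fn -> DP -> 'End(Fnr)) :
    set (I -> 'End(Fnr)) :=
  [set D | exists2 d, Lambda N d & D = (fun y : I => eta (\val y) d)].

End LAG.

(* Main.v *)
Require Import Defs.
From HB Require Import structures.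
From mathcomp Require Import all_boot all_order all_algebra all_fingroup all_field.
From mathcomp Require Import finmap generic_quotient.
From mathcomp Require Import boolp classical_sets functions fsbigop reals.

Set Implicit Arguments.
Unset Strict Implicit.
Unset Printing Implicit Defensive.

Import Order.TTheory GRing.Theory Num.Theory.

Local Open Scope ring_scope.
Local Open Scope classical_set_scope.

(* For y in I let gamma be the character of L with gamma(w_j) = B_j(y).  Through
   eta_y, Fnr is a module over Lambda_P; put c_i = 1 / tgam(i v).  Since
   c_r P(y) = 1, the operators eta_y(c_i T^i) form a cyclic group, and they
   have a common nonzero fixed vector x1, because their sum is nonzero: the
   T^i-coefficients of a multiple of Y - y cannot be nonzero constants.  Then
   S_y : x |-> eta_y(x) x1 is bijective and satisfies
     eta_y(a prod_j B_j^(l_j) T^i) S_y = S_y eps_gamma(a X^u),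
   with u = i v + sum_j l_j w_j.  So conjugation by the S_y carries the code to
   LAG codewords and preserves ranks.  The pole and degree conditions of
   Lambda_P(N) for these elements say that the coordinates l_j + i mu_j / r of
   u are nonnegative with sum at most c. *)

Lemma linfunE (K : fieldType) (U W : vectType K) (f : U -> W) :
  linear f -> linfun f =1 f.
Proof.
move=> lin x; pose fM := GRing.isLinear.Build K U W _ f lin.
by pose fL : {linear U -> W} := HB.pack f fM; rewrite (lfunE fL).
Qed.

(** * Fractions of polynomials *)

Section Fractions.
Variable K : fieldType.
Implicit Types (p q u v : {poly K}) (s : {fraction {poly K}}).

Lemma tofrac_neq0 p : (p%:F != 0) = (p != 0).
Proof. by rewrite tofrac_eq0. Qed.

Lemma frac_repr s : s * (\d_(repr s))%:F = (\n_(repr s))%:F.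
Proof.
rewrite -{1}[s]reprK; move: (repr s) => x.
unlock FracField.tofrac; rewrite -[LHS]FracField.pi_mul.
apply/eqmodP; rewrite /= FracField.equivfE /FracField.mulf.
by rewrite !numden_Ratio ?mulf_neq0 ?oner_neq0 ?denom_ratioP //= !mulr1 mulrC.
Qed.

(** [frac_map] reads off a chosen representative, which need not be [c / 1]. Its numerator is [c]
    times its denominator, and multiplicativity of [f] then settles the value. *)
Lemma frac_map_const (f : {poly K} -> {poly K}) (c : K) :
  {morph f : p q / p * q} -> (forall p, p != 0 -> f p != 0) ->
  frac_map f c%:P%:F = (f c%:P)%:F.
Proof.
move=> fM f0; set s := c%:P%:F; rewrite /frac_map.
have d0 : \d_(repr s) != 0 by apply: denom_ratioP.
have fd0 : (f \d_(repr s))%:F != 0 by rewrite tofrac_neq0 f0.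
apply: (mulIf fd0); rewrite divfK //.
rewrite -tofracM -fM; congr (f _)%:F.
by apply/eqP; rewrite -tofrac_eq -frac_repr tofracM.
Qed.

End Fractions.

(** * The algebra behind the LAG code and its action on [Fnr] at a point *)

Section LAGCode.
Variables (Fn : fieldType) (Fnr : fieldExtType Fn) (r : nat).
Variables (theta : 'AEnd(Fnr)) (P : {poly Fn}).

Lemma theta_frac_const (c : Fnr) : theta_frac theta c%:P%:F = (theta c)%:P%:F.
Proof.
rewrite /theta_frac frac_map_const ?map_polyC //= => [p q|p].
  by rewrite rmorphM.
by rewrite map_poly_eq0.
Qed.

Lemma iter_theta_frac_const k (c : Fnr) :
  iter k (theta_frac theta) c%:P%:F = (iter k theta c)%:P%:F.
Proof. by elim: k => //= k ->; apply: theta_frac_const. Qed.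

Lemma DP_monomD (i : 'I_r) (s t : {fraction {poly Fnr}}) :
  DP_monom i (s + t) = DP_monom i s + DP_monom i t.
Proof. by apply/ffunP=> k; rewrite !ffunE; case: ifP; rewrite ?addr0. Qed.

Lemma DP_scale_monom (i : 'I_r) (s t : {fraction {poly Fnr}}) :
  DP_scale s (DP_monom i t) = DP_monom i (s * t).
Proof. by apply/ffunP=> k; rewrite !ffunE; case: ifP; rewrite ?mulr0. Qed.

(* T^r = P, so the exponent i + j is reduced modulo r. *)
Lemma DP_mul_monom (i j k : 'I_r) (s : {fraction {poly Fnr}}) (c : Fnr) :
  k = ((i + j) %% r)%N :> nat ->
  DP_mul theta P (DP_monom i s) (DP_monom j c%:P%:F) =
  DP_monom k (s * (iter i theta c)%:P%:F *
              (if (r <= i + j)%N then (ext_poly Fnr P)%:F else 1)).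
Proof.
move=> kE; apply/ffunP=> l; rewrite !ffunE.
have th0 a : iter a (theta_frac theta) (0 : {fraction {poly Fnr}}) = 0.
  by elim: a => //= a ->; have := theta_frac_const 0; rewrite rmorph0 !rmorph0.
rewrite (bigD1 i) //= [X in _ + X]big1 ?addr0 => [|i' ii']; last first.
  by apply: big1 => j' _; rewrite !ffunE (negPf ii') !mul0r !if_same.
rewrite (bigD1 j) //= [X in _ + X]big1 ?addr0 => [|j' jj']; last first.
  by rewrite !ffunE (negPf jj') th0 mulr0 mul0r !if_same.
rewrite !ffunE !eqxx iter_theta_frac_const -(inj_eq val_inj l k) /= kE.
(* Both exponents are below [r], so reduction modulo [r] subtracts [r] at most once. *)
have ij2 : (i + j < r + r)%N by rewrite -addnS leq_add // ltnW.
have [rij|rij] := leqP r (i + j).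
  rewrite -(subnK rij) modnDr modn_small; last by rewrite ltn_subLR.
  rewrite eqn_add2r (eq_sym (nat_of_ord l)) gtn_eqF //.
  by rewrite ltn_addl.
rewrite modn_small // (eq_sym (nat_of_ord l)) mulr1; case: ifP => // _.
by rewrite ltn_eqF // ltn_addl.
Qed.

(** Dividing [U] and [V] by their gcd lowers both degrees equally and replaces [V] by a divisor, so
    the degree and pole conditions pass to the reduced fraction. A zero coefficient is written
    [0 / 1]. *)
Lemma Lambda_frac N (d : DP Fnr r) :
  (forall i, exists U V : {poly Fnr},
     [/\ V != 0, d i = U%:F / V%:F,
         U != 0 -> (r * (size U).-1 + i * (size P).-1 <= N + r * (size V).-1)%N &
         V ^+ r %| ext_poly Fnr P ^+ i]) ->
  Lambda P N d.
Proof.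
move=> dE i; have [U [V [V0 -> szU dvdV]]] := dE i.
have [->|U0] := eqVneq U 0.
  exists 0, 1; split; rewrite ?oner_eq0 ?eqxx ?coprimep1 ?expr1n ?dvd1p //.
  by rewrite tofrac0 !mul0r.
pose g := gcdp U V; have g0 : g != 0 by rewrite gcdp_eq0 negb_and U0.
have UE : U = U %/ g * g by rewrite divpK ?dvdp_gcdl.
have VE : V = V %/ g * g by rewrite divpK ?dvdp_gcdr.
have u0 : U %/ g != 0 by apply: contraNneq U0 => u0; rewrite UE u0 mul0r.
have v0 : V %/ g != 0 by apply: contraNneq V0 => v0; rewrite VE v0 mul0r.
have szM (a : {poly Fnr}) : a != 0 -> (size (a * g)).-1 = ((size a).-1 + (size g).-1)%N.
  move=> a0; rewrite size_mul //.
  by case: (size a) (size g) (size_poly_eq0 a) (size_poly_eq0 g) => [|x] [|z];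
     rewrite ?(negPf a0) ?(negPf g0) //= addnS.
exists (U %/ g), (V %/ g); split=> //.
- by rewrite {1}UE {1}VE !tofracM -mulf_div divff ?mulr1 ?tofrac_neq0.
- by rewrite coprimep_div_gcd ?U0.
- move: (szU U0); rewrite {1}UE {1}VE !szM // => szu _.
  rewrite mulrBr addrAC lerBlDr -!PoszM -!PoszD lez_nat.
  by rewrite -(leq_add2r (r * (size g).-1)) addnAC -mulnDr -addnA -mulnDr.
- by apply: dvdp_trans dvdV; rewrite {2}VE dvdp_exp2r // dvdp_mulIl.
Qed.

Section Denominators.
Variable V : 'I_r -> {poly Fnr}.
Hypothesis V_neq0 : forall i, V i != 0.
Hypothesis V_dvd : forall i, V i ^+ r %| ext_poly Fnr P ^+ i.

(** Fixing the denominator [V i] of each coefficient makes the degree bound stable under sums, with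
    no new reduction to lowest terms. *)
Definition bounded_num N (d : DP Fnr r) : Prop := forall i, exists U : {poly Fnr},
  d i = U%:F / (V i)%:F /\
  (U != 0 -> (r * (size U).-1 + i * (size P).-1 <= N + r * (size (V i)).-1)%N).

Lemma bounded_num_Lambda N d : bounded_num N d -> Lambda P N d.
Proof.
move=> dN; apply: Lambda_frac => i; have [U [dE szU]] := dN i.
by exists U, (V i).
Qed.

Lemma bounded_num_le M N d : (M <= N)%N -> bounded_num M d -> bounded_num N d.
Proof.
move=> leMN dM i; have [U [dE szU]] := dM i; exists U; split=> // /szU.
by move=> /leq_trans; apply; rewrite leq_add2r.
Qed.

Lemma bounded_num0 N : bounded_num N 0.
Proof. by move=> i; exists 0; rewrite eqxx ffunE tofrac0 mul0r. Qed.

Lemma bounded_numD N d d' :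
  bounded_num N d -> bounded_num N d' -> bounded_num N (d + d').
Proof.
move=> dN d'N i; have [U [dE szU]] := dN i; have [U' [d'E szU']] := d'N i.
exists (U + U'); split=> [|UU'0]; first by rewrite ffunE dE d'E tofracD mulrDl.
have [U0|U0] := eqVneq U 0; first by move: UU'0; rewrite U0 add0r; apply: szU'.
have [U'0|U'0] := eqVneq U' 0; first by move: UU'0; rewrite U'0 addr0; apply: szU.
have := size_polyD U U'; rewrite leq_max => /orP[] le.
  by apply: leq_trans (szU U0); rewrite leq_add2r leq_mul2l -!subn1 leq_sub2r ?orbT.
by apply: leq_trans (szU' U'0); rewrite leq_add2r leq_mul2l -!subn1 leq_sub2r ?orbT.
Qed.

Lemma bounded_numZ N (c : Fnr) d :
  bounded_num N d -> bounded_num N (DP_scale c%:P%:F d).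
Proof.
move=> dN i; have [U [dE szU]] := dN i; exists (c%:P * U); split.
  by rewrite ffunE dE tofracM mulrA.
rewrite mulf_eq0 negb_or polyC_eq0 => /andP[c0 /szU].
by rewrite mul_polyC size_scale.
Qed.

Lemma bounded_num_monom N (i : 'I_r) (U : {poly Fnr}) :
  (U != 0 -> (r * (size U).-1 + i * (size P).-1 <= N + r * (size (V i)).-1)%N) ->
  bounded_num N (DP_monom i (U%:F / (V i)%:F)).
Proof.
move=> szU k; rewrite ffunE; case: eqP => [->|_]; first by exists U.
by exists 0; rewrite eqxx tofrac0 mul0r.
Qed.

Definition regular d := exists N, bounded_num N d.

Lemma regular_LambdaU d : regular d -> LambdaU P d.
Proof. by case=> N /bounded_num_Lambda ?; exists N. Qed.

Lemma regularD d d' : regular d -> regular d' -> regular (d + d').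
Proof.
move=> [N dN] [N' d'N]; exists (maxn N N').
by apply: bounded_numD; [apply: bounded_num_le dN|apply: bounded_num_le d'N];
   rewrite leq_max leqnn ?orbT.
Qed.

Lemma regular_sum (I : Type) (s : seq I) (d : I -> DP Fnr r) :
  (forall k, regular (d k)) -> regular (\sum_(k <- s) d k).
Proof.
move=> reg; elim/big_rec: _ => [|k x _]; last exact: regularD.
by exists 0%N; apply: bounded_num0.
Qed.

Lemma regular_monom i (U : {poly Fnr}) : regular (DP_monom i (U%:F / (V i)%:F)).
Proof.
exists (r * (size U).-1 + i * (size P).-1)%N.
by apply: bounded_num_monom => _; rewrite leq_addr.
Qed.

Lemma constE i (c : Fnr) : c%:P%:F = (c%:P * V i)%:F / (V i)%:F.
Proof. by rewrite tofracM mulfK ?tofrac_neq0. Qed.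

Lemma regular_const i (c : Fnr) : regular (DP_monom i c%:P%:F).
Proof. by rewrite (constE i); apply: regular_monom. Qed.

Section Evaluation.
Variables (y : Fn) (eta : DP Fnr r -> 'End(Fnr)).
Hypothesis etaP : quotient_map theta P y eta.
Hypothesis Vy_neq0 : forall i, (V i).[y%:A] != 0.

Lemma etaD d d' : regular d -> regular d' -> eta (d + d') = eta d + eta d'.
Proof.
case: etaP => lin _ _ _ _ dr d'r; rewrite -[eta d]scale1r.
rewrite -lin; do ?exact: regular_LambdaU.
congr eta; congr (_ + _); apply/ffunP=> k.
by rewrite ffunE scale1r tofrac1 mul1r.
Qed.

Lemma eta0 : eta 0 = 0.
Proof.
have r0 : regular 0 by exists 0%N; apply: bounded_num0.
by apply/esym/(addrI (eta 0)); rewrite -etaD // !addr0.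
Qed.

Lemma etaZ (a : Fn) d : regular d -> eta (DP_scale (a%:A)%:P%:F d) = a *: eta d.
Proof.
case: etaP => lin _ _ _ _ dr; rewrite -[DP_scale _ _]addr0 lin ?eta0 ?addr0 //.
  exact: regular_LambdaU.
by apply: regular_LambdaU; exists 0%N; apply: bounded_num0.
Qed.

Lemma eta_sum (I : Type) (s : seq I) (d : I -> DP Fnr r) :
  (forall k, regular (d k)) -> eta (\sum_(k <- s) d k) = \sum_(k <- s) eta (d k).
Proof.
move=> reg; elim: s => [|k s IHs]; first by rewrite !big_nil eta0.
by rewrite !big_cons etaD ?IHs //; apply: regular_sum.
Qed.

(** The polynomial [U - c V_i] has the root [y], so the two coefficients differ by [Y - y] times a
    fraction over [V i], and [eta] kills such a multiple. *)
Lemma eta_eval i (U : {poly Fnr}) :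
  eta (DP_monom i (U%:F / (V i)%:F)) =
  eta (DP_monom i (U.[y%:A] / (V i).[y%:A])%:P%:F).
Proof.
set c := U.[_] / _.
have /factor_theorem[U' U'E] : root (U - c%:P * V i) y%:A.
  by rewrite /root hornerD hornerN hornerM hornerC /c divfK ?subrr.
have -> : U%:F / (V i)%:F =
          c%:P%:F + ('X - (y%:A)%:P)%:F * (U'%:F / (V i)%:F).
  by rewrite (constE i) mulrA -tofracM -mulrDl -tofracD [_ * U']mulrC -U'E addrC subrK.
have regX : regular (DP_monom i (('X - (y%:A)%:P)%:F * (U'%:F / (V i)%:F))).
  by rewrite mulrA -tofracM; apply: regular_monom.
rewrite DP_monomD etaD //; last exact: regular_const.
suff -> : eta (DP_monom i (('X - (y%:A)%:P)%:F * (U'%:F / (V i)%:F))) = 0.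
  by rewrite addr0.
case: etaP => _ _ _ _ ker; apply/(ker _ (regular_LambdaU regX)).
exists (DP_monom i (U'%:F / (V i)%:F)); last by rewrite DP_scale_monom.
exact/regular_LambdaU/regular_monom.
Qed.

Lemma eta_constM (i j k : 'I_r) (b a : Fnr) : k = ((i + j) %% r)%N :> nat ->
  (eta (DP_monom i b%:P%:F) \o eta (DP_monom j a%:P%:F))%VF =
  eta (DP_monom k
    (b * iter i theta a * (if (r <= i + j)%N then P.[y]%:A else 1))%:P%:F).
Proof.
move=> kE; case: etaP => _ etaM _ _ _.
rewrite -etaM; do ?by apply/regular_LambdaU; apply: regular_const.
rewrite (DP_mul_monom _ _ kE).
set e := (if _ then P.[y]%:A else 1).
pose p := if (r <= i + j)%N then ext_poly Fnr P else 1.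
have pE : p.[y%:A] = e.
  rewrite /p /e; case: ifP => _; last by rewrite hornerC.
  by rewrite /ext_poly horner_map.
have -> : (if (r <= i + j)%N then (ext_poly Fnr P)%:F else 1) = p%:F.
  by rewrite /p; case: ifP.
rewrite -!tofracM -[X in DP_monom k X]mulr1 -(divff (x := (V k)%:F)) ?tofrac_neq0 //.
by rewrite mulrA -tofracM eta_eval hornerM mulfK // !hornerM !hornerC pE.
Qed.

(** * The cyclic group of operators and the intertwiner *)

Section Intertwiner.
Variable c : nat -> Fnr.
Hypothesis r_gt0 : (0 < r)%N.
Hypothesis c_neq0 : forall k, c k != 0.
Hypothesis cD : forall i j, c (i + j)%N = c i * iter i theta (c j).
Hypothesis cr : c r * P.[y]%:A = 1.

Lemma iter_thetaZ k (a : Fn) x : iter k theta (a *: x) = a *: iter k theta x.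
Proof. by elim: k => //= k ->; rewrite linearZ. Qed.

Lemma iter_thetaA k (a : Fn) : iter k theta a%:A = a%:A.
Proof. by rewrite iter_thetaZ; congr (_ *: _); elim: k => //= k ->; rewrite rmorph1. Qed.

Lemma iter_thetaM k : {morph iter k theta : x z / x * z}.
Proof. by move=> x z; elim: k => //= k ->; rewrite rmorphM. Qed.

(** The value [P(y)] lies in [Fn], hence is fixed by [theta^k]; so [c_(k+r) P(y) = c_k theta^k(c_r
    P(y)) = c_k]. *)
Lemma c_periodic k : c (k + r)%N * P.[y]%:A = c k.
Proof.
rewrite cD -mulrA -[P.[y]%:A](iter_thetaA k) -iter_thetaM cr -[1]scale1r.
by rewrite iter_thetaA scale1r mulr1.
Qed.

Let res k : 'I_r := Ordinal (ltn_pmod k r_gt0).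
Let G k := eta (DP_monom (res k) (c (k %% r))%:P%:F).

(** When [i + j >= r], the relation [T^r = P] contributes a factor [P(y)], which by [c_periodic] is
    just what turns [c (i + j)] into [c (i + j - r)]. *)
Lemma intertwiner_cyclic (i j : 'I_r) : (G i \o G j)%VF = G (i + j).
Proof.
rewrite /G (eta_constM (k := res (i + j))) ?modnDml ?modnDmr //.
congr (eta (DP_monom _ _%:P%:F)).
rewrite /= (modn_small (ltn_ord i)) (modn_small (ltn_ord j)) -cD.
have [rij|rij] := leqP r (i + j); last by rewrite modn_small // mulr1.
rewrite -(subnK rij) modnDr c_periodic modn_small //.
by rewrite ltn_subLR // -addnS leq_add // ltnW.
Qed.

Lemma sum_periodic (W : zmodType) (g : nat -> W) i :
  (forall k, g (k + r)%N = g k) -> \sum_(j < r) g (i + j)%N = \sum_(j < r) g j.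
Proof.
move=> per; elim: i => // i <-.
case: r per => [|r'] per; first by rewrite !big_ord0.
rewrite big_ord_recr /= [RHS]big_ord_recl /= addrC addSnnS per addn0; congr (_ + _).
by apply: eq_bigr => j _; rewrite /bump addSnnS.
Qed.

Lemma fixed_vector : exists2 x1, x1 != 0 &
  forall i : 'I_r, eta (DP_monom i (c i)%:P%:F) x1 = x1.
Proof.
have GE (i : 'I_r) : G i = eta (DP_monom i (c i)%:P%:F).
  rewrite /G modn_small //; congr (eta (DP_monom _ _)).
  by apply/val_inj; rewrite /= modn_small.
have Gper k : G (k + r) = G k.
  rewrite /G modnDr; congr (eta (DP_monom _ _)).
  by apply/val_inj; rewrite /= modnDr.
have sumG0 : \sum_(j < r) G j != 0.
  under eq_bigr do rewrite GE.
  pose d : DP Fnr r := \sum_(j < r) DP_monom j (c j)%:P%:F.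
  have dreg : regular d by apply: regular_sum => j; apply: regular_const.
  rewrite -eta_sum => [|j]; last exact: regular_const.
  (* If the sum vanished, [d] would be [(Y - y) d'] with [d'] in some [Lambda]; the coefficients of
     [T^0] are compared. *)
  case: etaP => _ _ _ _ ker; apply/eqP => /(ker _ (regular_LambdaU dreg)).
  case=> d' [N d'N] /ffunP/(_ (Ordinal r_gt0)).
  have [u [v [v0 d'E _ _]]] := d'N (Ordinal r_gt0).
  (* For [i = 0] the pole condition reads [v^r | 1], so [v] is a nonzero constant. *)
  rewrite expr0 dvdp1 => /eqP szv.
  have /size_poly1P[k k0 vE] : size v == 1%N.
    have := size_exp v r; rewrite szv /= => /esym/eqP.
    rewrite muln_eq0 (gtn_eqF r_gt0) orbF; move: v0; rewrite -size_poly_eq0.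
    by case: (size v) => [|[]].
  rewrite !ffunE d'E sum_ffunE (bigD1 (Ordinal r_gt0)) //=.
  rewrite big1 => [|j /negPf j0]; last by rewrite ffunE eq_sym j0.
  rewrite ffunE eqxx addr0 mulrA -tofracM => /(congr1 ( *%R^~ v%:F)).
  rewrite divfK ?tofrac_neq0 // -tofracM => /eqP; rewrite tofrac_eq => /eqP.
  (* At [y] the multiple of [Y - y] vanishes, whereas [c_0 v] does not. *)
  move=> /(congr1 (horner^~ y%:A)); rewrite !hornerM hornerXsubC subrr mul0r.
  by rewrite vE !hornerC => /eqP; rewrite mulf_eq0 (negPf k0) (negPf (c_neq0 _)).
have [x0 x00] : exists x0, (\sum_(j < r) G j) x0 != 0.
  apply: contrapT => nox; case/negP: sumG0; apply/eqP/lfunP => x.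
  by rewrite zero_lfunE; apply/eqP/negPn/negP => nz; apply: nox; exists x.
exists ((\sum_(j < r) G j) x0) => // i.
rewrite -GE sum_lfunE linear_sum /=.
rewrite -(sum_periodic (g := fun k => G k x0) i) => [|k]; last by rewrite Gper.
by apply: eq_bigr => j _; rewrite -comp_lfunE intertwiner_cyclic.
Qed.

(* Both eta and the evaluation s T^i |-> (x |-> s(y) c_i^-1 theta^i(x)) turn
   Fnr into a module over Lambda_P; S is the isomorphism sending 1 to the
   vector fixed by all the c_i T^i. *)
Lemma intertwiner : exists2 S : 'End(Fnr), lker S == 0%VS &
  forall i (U : {poly Fnr}) x,
    eta (DP_monom i (U%:F / (V i)%:F)) (S x) =
    S (U.[y%:A] / (V i).[y%:A] / c i * iter i theta x).
Proof.
have [x1 x10 x1E] := fixed_vector; pose o := Ordinal r_gt0.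
pose f x := eta (DP_monom o x%:P%:F) x1.
have flin : linear f.
  move=> a x z; rewrite /f -mulr_algl polyCD polyCM tofracD tofracM DP_monomD.
  rewrite -DP_scale_monom etaD ?etaZ; do ?exact: regular_const.
    by rewrite !lfunE /= lfunE.
  by rewrite DP_scale_monom -tofracM -polyCM; apply: regular_const.
have c0 : c 0 = 1 by apply/(mulfI (c_neq0 0)); rewrite -cD mulr1.
have f1 : eta (DP_monom o 1%:P%:F) = \1%VF.
  case: etaP => _ _ <- _ _; congr eta; apply/ffunP => k; rewrite !ffunE.
  by rewrite polyC1 tofrac1 -(inj_eq val_inj) /=; case: eqP.
exists (linfun f) => [|i U x].
  (* If [f x = 0] with [x] nonzero, applying the scalar [x^-1] gives [x1 = 0]. *)
  apply/lker0P; apply: raddf_inj => x /=; rewrite (linfunE flin) => fx0.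
  apply/eqP; apply: contraNT x10 => x0.
  have : (eta (DP_monom o (x^-1)%:P%:F) \o eta (DP_monom o x%:P%:F))%VF = \1%VF.
    by rewrite (eta_constM (k := o)) //= ?mod0n // add0n leqNgt r_gt0 mulr1 mulVf.
  by move=> /lfunP/(_ x1); rewrite comp_lfunE -/(f x) fx0 linear0 id_lfunE => <-.
(* The vector [x1] is fixed by [c_i T^i], so [z] and [z c_i T^i] send it to the same place. *)
have fE z : f z = eta (DP_monom i (z * c i)%:P%:F) x1.
  have := eta_constM (i := o) (j := i) (k := i) z (c i).
  rewrite /= add0n modn_small // leqNgt ltn_ord /= mulr1 => /(_ erefl) <-.
  by rewrite comp_lfunE x1E.
(* Moving [T^i] past the scalar [x] yields [theta^i(x)]; then [fE] removes [T^i] at the price of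
   dividing by [c_i]. *)
have := eta_constM (i := i) (j := o) (k := i) (U.[y%:A] / (V i).[y%:A]) x.
rewrite /= addn0 modn_small // leqNgt ltn_ord /= mulr1 => /(_ erefl)/lfunP/(_ x1).
rewrite !(linfunE flin) eta_eval comp_lfunE -/(f x) => ->.
by rewrite fE (mulrAC _ (iter i theta x)) divfK.
Qed.


End Intertwiner.
End Evaluation.
End Denominators.
End LAGCode.

(** * Linear disjointness of [Fr] and [Fn] over [F] *)

Section LinearDisjointness.
Variables (F : finFieldType) (Fr : fieldExtType F) (Fn : fieldExtType F).
Variables (Fnr : fieldExtType Fn) (iota : {rmorphism Fr -> Fnr}).
Hypothesis iotaF : forall a : F, iota a%:A = (a%:A : Fn)%:A.
Variable theta : 'AEnd(Fnr).
Hypothesis thetaP : forall x, theta (iota x) = iota (x ^+ #|F|).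

Lemma iotaZ (a : F) x : iota (a *: x) = (a%:A : Fn) *: iota x.
Proof. by rewrite -[a *: x]mulr_algl rmorphM iotaF mulr_algl. Qed.

Lemma iter_theta_iota k x : iter k theta (iota x) = iota (x ^+ (#|F| ^ k)).
Proof.
elim: k => [|k /= ->]; first by rewrite expr1.
by rewrite thetaP -exprM expnSr.
Qed.

Lemma iter_theta_linear k : linear (iter k theta).
Proof. by move=> a x z; elim: k => //= k ->; rewrite linearP. Qed.

Lemma frob_linear k : linear (fun x : Fr => x ^+ (#|F| ^ k)).
Proof.
move=> a x z; apply: (fmorph_inj iota).
rewrite rmorphD /= iotaZ -!iter_theta_iota rmorphD /= iotaZ.
exact: iter_theta_linear.
Qed.

(** With [q = #|F|], the polynomial with terms [d_j X^(q^j)] has degree below [q^(dim Fr)] yet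
    vanishes at all [q^(dim Fr)] elements of [Fr]. *)
Lemma frob_poly_eq0 (d : 'rV[Fr]_(\dim {:Fr})) :
  (forall x : Fr, \sum_j d 0 j * x ^+ (#|F| ^ j) = 0) -> d = 0.
Proof.
move=> d0; have q1 : (1 < #|F|)%N by apply: finNzRing_gt1.
pose p := \sum_(j < \dim {:Fr}) (d 0 j)%:P * 'X^(#|F| ^ j).
have rp x : root p x.
  rewrite /root horner_sum; apply/eqP; rewrite -[RHS](d0 x).
  by apply: eq_bigr => j _; rewrite hornerM hornerC hornerXn.
have p0 : p = 0.
  apply: contrapT => /eqP pn0.
  have cardFr : #|finvect_type Fr| = (#|F| ^ \dim {:Fr})%N.
    pose cV := Vector.class (finvect_type Fr : vectType F).
    by rewrite -(@card_vspacef F (finvect_type Fr) cV) card_vspace.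
  have := max_poly_roots pn0 (rs := enum (finvect_type Fr)).
  rewrite enum_uniq -cardE cardFr.
  have -> : all (root p) (enum (finvect_type Fr)) by apply/allP => x _; apply: rp.
  move=> /(_ isT isT); apply/negP; rewrite -leqNgt.
  apply: leq_trans (size_sum _ _ _) _; apply/bigmax_leqP => j _.
  rewrite mul_polyC; apply: leq_trans (size_scale_leq _ _) _.
  by rewrite size_polyXn ltn_exp2l.
apply/rowP => j; rewrite mxE.
have := congr1 (fun f : {poly Fr} => f`_(#|F| ^ j)) p0.
rewrite coef0 coef_sum (bigD1 j) //= big1 => [|k kj].
  by rewrite coefCM coefXn eqxx mulr1 addr0.
by rewrite coefCM coefXn eqn_exp2l // eq_sym (inj_eq val_inj) (negPf kj) mulr0.
Qed.

(* The Moore matrix (b_i^(q^j)) of a basis b of Fr over F is invertible, and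
   applying powers of theta to an Fn-linear relation between the iota b_i puts
   it in the kernel of that matrix. *)
Lemma iota_free : free [tuple of map iota (vbasis {:Fr})].
Proof.
set X := vbasis {:Fr}; pose N : 'M[Fr]_(\dim {:Fr}) := \matrix_(j, i) X`_i ^+ (#|F| ^ j).
have Nu : N \in unitmx.
  (* A row killed by [N] is a Frobenius polynomial vanishing on the basis, hence by [F]-linearity on
     all of [Fr]. *)
  rewrite unitmxE unitfE; apply/det0P => -[d dn0 dN]; case/eqP: dn0.
  apply: frob_poly_eq0 => x; rewrite (coord_vbasis (memvf x)).
  pose f y := \sum_j d 0 j * y ^+ (#|F| ^ j).
  have flin : linear f.
    move=> a y z; rewrite /f scaler_sumr -big_split; apply: eq_bigr => j _ /=.
    by rewrite frob_linear mulrDr scalerAr.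
  rewrite -/(f _) -(linfunE flin) linear_sum big1 // => i _; rewrite linearZ /=.
  rewrite (linfunE flin) -/X; have /rowP/(_ i) := dN; rewrite !mxE => fX.
  rewrite -[RHS](scaler0 _ (coord X i x)); congr (_ *: _); rewrite -[RHS]fX.
  by apply: eq_bigr => j _; rewrite mxE.
apply/freeP => k kX i.
have kN : map_mx iota N *m (\col_i (k i)%:A) = 0.
  apply/colP => j; rewrite !mxE; have := congr1 (iter j theta) kX.
  pose th := linfun (iter j theta).
  rewrite -!(linfunE (iter_theta_linear j)) linear0 linear_sum => th0.
  rewrite -[RHS]th0.
  apply: eq_bigr => l _; rewrite !mxE linearZ /= (linfunE (iter_theta_linear j)).
  by rewrite (nth_map 0) ?size_tuple // iter_theta_iota mulr_algr.
have Nu' : map_mx iota N \in unitmx by rewrite map_unitmx.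
have := mulKmx Nu' (\col_i (k i)%:A); rewrite kN mulmx0 => /colP/(_ i)/esym/eqP.
by rewrite !mxE scaler_eq0 oner_eq0 orbF => /eqP.
Qed.

(** By [iota_free] and the equality of dimensions, [iota] carries an [F]-basis of [Fr] to an
    [Fn]-basis of [Fnr]. So the map [g] in [extends f g] is determined by [f]. *)
Lemma lfun_iota_eq (f g : 'End(Fnr)) : \dim {:Fnr} = \dim {:Fr} ->
  (forall x, f (iota x) = g (iota x)) -> f = g.
Proof.
move=> dimE fg; apply/lfunP => x.
pose X := [tuple of map iota (vbasis {:Fr})].
have Xspan : <<X>>%VS = fullv.
  apply/eqP; rewrite eqEdim subvf dimE.
  by move: iota_free; rewrite /free => /eqP ->; rewrite size_tuple leqnn.
have : x \in <<X>>%VS by rewrite Xspan memvf.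
move=> /coord_span ->; rewrite !linear_sum; apply: eq_bigr => i _.
by rewrite !linearZ /= (nth_map 0) ?size_tuple // fg.
Qed.

End LinearDisjointness.

(** * The trace forms [beta] as coordinates on [Fn] *)

Section Trace.
Variables (F : finFieldType) (Fn : splittingFieldType F).
Variables (n : nat) (b : n.-tuple Fn).
Hypothesis b_basis : basis_of {:Fn} b.

(** Extensions of finite fields are Galois, so traces down to [F] lie in [F]. *)
Lemma betaP : exists bF : nat -> Fn -> F, forall i y, beta b i y = (bF i y)%:A.
Proof.
have /choice[f fE] : forall iy : nat * Fn, exists a : F, beta b iy.1 iy.2 = a%:A.
  move=> [i y]; apply/vlineP; apply: (@mem_galTrace _ _ 1%AS {:Fn}%AS) => //.
    by apply: finField_galois; apply: sub1v.
  exact: memvf.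
by exists (fun i y => f (i, y)) => i y; apply: (fE (i, y)).
Qed.

Lemma galTraceZ (a : F) (z : Fn) :
  galTrace 1 {:Fn} (a *: z) = a *: galTrace 1 {:Fn} z.
Proof. by rewrite /galTrace scaler_sumr; apply: eq_bigr => x _; apply: linearZ. Qed.

Lemma beta_linear i : linear (beta b i).
Proof. by move=> a y z; rewrite /beta mulrDr raddfD /= -scalerAr galTraceZ. Qed.

(** Nondegeneracy of the trace form: otherwise the trace would vanish on all of [Fn], against the
    linear independence of automorphisms. *)
Lemma beta_eq0 y : (forall j, (j < n)%N -> beta b j y = 0) -> y = 0.
Proof.
move=> by0; apply: contrapT => /eqP y0.
have tr0 x : galTrace 1 {:Fn} (x * y) = 0.
  have /coord_span -> : x \in <<b>>%VS by rewrite (span_basis b_basis) memvf.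
  rewrite mulr_suml raddf_sum big1 //= => j _.
  by rewrite -scalerAl galTraceZ -/(beta b j y) by0 ?scaler0.
have all0 x : x \in {:Fn}%AS -> \sum_(s in 'Gal({:Fn} / 1)%g) 1 * s x = 0.
  move=> _; rewrite -[RHS](tr0 (x / y)) divfK //.
  by apply: eq_bigr => s _; rewrite mul1r.
by have /eqP := gal_independent all0 (group1 _); rewrite oner_eq0.
Qed.

(** By [beta_eq0] the [n] forms give an injective linear map to [F^n], which is onto because the
    dimensions agree. *)
Lemma beta_surj : \dim {:Fn} = n -> forall t : nat -> F,
  exists y, forall j, (j < n)%N -> beta b j y = (t j)%:A.
Proof.
move=> dimE t; have [bF bFE] := betaP.
pose f y : 'rV[F]_n := \row_j bF j y.
have flin : linear f.
  move=> a y z; apply/rowP => j; rewrite !mxE.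
  apply: (fmorph_inj (in_alg Fn)); rewrite /= scalerDl -scalerA -!bFE.
  exact: beta_linear.
have ker0 : lker (linfun f) == 0%VS.
  apply/lker0P; apply: raddf_inj => y /=; rewrite (linfunE flin) => /rowP f0.
  apply: beta_eq0 => j jn; have := f0 (Ordinal jn).
  by rewrite !mxE /= bFE => ->; rewrite scale0r.
have imf : limg (linfun f) = fullv.
  apply/eqP; rewrite eqEdim subvf limg_dim_eq ?(eqP ker0) ?capv0 //.
  by rewrite dimE dimvf /dim /= mul1n.
have /memv_imgP[y _ yE] : (\row_j t j : 'rV[F]_n) \in limg (linfun f).
  by rewrite imf memvf.
exists y => j jn; have := congr1 (fun A : 'rV_n => A 0 (Ordinal jn)) yE.
by rewrite (linfunE flin) !mxE bFE => <-.
Qed.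

End Trace.

(** * Bases of the lattice [L] *)

Section LatticeBasis.
Variables (m r : nat) (e : 'rV[int]_m) (w : 'I_m -> lattice r e).

Lemma lat_val_sum (l : 'I_m -> int) :
  lat_val (\sum_i w i *~ l i) = \sum_i lat_val (w i) *~ l i.
Proof.
rewrite -[lat_val _]/(val _) raddf_sum; apply: eq_bigr => i _.
exact: raddfMz.
Qed.

Lemma dotzD (u z1 z2 : 'rV[int]_m) : dotz u (z1 + z2) = dotz u z1 + dotz u z2 :> int.
Proof. by rewrite /dotz -big_split; apply: eq_bigr => i _; rewrite mxE mulrDr. Qed.

Lemma dotzB (u z1 z2 : 'rV[int]_m) : dotz u (z1 - z2) = dotz u z1 - dotz u z2 :> int.
Proof. by rewrite /dotz -sumrB; apply: eq_bigr => i _; rewrite !mxE mulrBr. Qed.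

Lemma dotzMn (u z : 'rV[int]_m) k : dotz u (z *+ k) = dotz u z *+ k :> int.
Proof.
elim: k => [|k IHk]; last by rewrite !mulrS dotzD IHk.
by rewrite !mulr0n /dotz big1 // => i _; rewrite mxE mulr0.
Qed.

Lemma lattice_dvd (u : lattice r e) : (r %| dotz e (lat_val u))%Z.
Proof. by case: u. Qed.

Hypothesis wP : Zbasis w.

Lemma Zbasis_coord : exists crd : lattice r e -> 'I_m -> int,
  (forall u, u = \sum_i w i *~ crd u i) /\
  (forall u l, u = \sum_i w i *~ l i -> crd u =1 l).
Proof.
have /choice[crd crdE] : forall u, exists l : {ffun 'I_m -> int}, u = \sum_i w i *~ l i.
  by move=> u; have [l [lE _]] := wP u; exists l.
exists (fun u => crd u); split=> // u l ul i.
have [l' [_ l'U]] := wP u.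
have /ffunP/(_ i) : crd u = finfun l.
  rewrite -(l'U (crd u)) // -(l'U (finfun l)) // ul.
  by apply: eq_bigr => j _; rewrite ffunE.
by rewrite ffunE.
Qed.

(* The determinant of w is nonzero because r Z^m is contained in the lattice. *)
Lemma Zbasis_free (R : realType) (z : 'I_m -> R) : (0 < r)%N ->
  \sum_i z i *: map_mx intr (lat_val (w i)) = 0 :> 'rV[R]_m -> forall i, z i = 0.
Proof.
move=> r_gt0 z0 i.
pose W : 'M[int]_m := \matrix_i lat_val (w i).
have delta_lat k : (delta_mx 0 k *+ r : 'rV[int]_m) \in in_lat r e.
  by rewrite !inE dotzMn -mulr_natr natz dvdz_mull ?dvdzz.
have [crd [crdE _]] := Zbasis_coord.
pose C : 'M[int]_m := \matrix_(k, j) crd (Lattice (delta_lat k)) j.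
have CW : C *m W = (r%:Z)%:M.
  apply/row_matrixP => k; apply/rowP => j; rewrite !mxE.
  have := congr1 (fun u => lat_val u 0 j) (crdE (Lattice (delta_lat k))).
  rewrite lat_val_sum /= summxE mulmxnE mxE eqxx /= [j == k]eq_sym => kj.
  have -> : r%:Z *+ (k == j) = (k == j)%:R *+ r.
    by case: (k == j); rewrite ?mul0rn ?mulr1n ?natz.
  rewrite kj; apply: eq_bigr => l _.
  by rewrite !mxE -scaler_int mxE intz.
have WR : map_mx (intr : int -> R) W \in unitmx.
  have := congr1 (fun A => \det (map_mx (intr : int -> R) A)) CW.
  rewrite map_mxM det_mulmx map_scalar_mx det_scalar unitmxE unitfE => detE.
  apply: contraTneq isT => W0; have /eqP := detE; rewrite W0 mulr0 eq_sym.
  by rewrite expf_eq0 pnatr_eq0 (gtn_eqF r_gt0) andbF.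
have zW : (\row_i z i) *m map_mx (intr : int -> R) W = 0.
  rewrite -[RHS]z0 mulmx_sum_row; apply: eq_bigr => k _.
  by rewrite mxE -map_row rowK.
have := mulmxK WR (\row_i z i); rewrite zW mul0mx => /rowP/(_ i).
by rewrite !mxE.
Qed.

End LatticeBasis.

(** * Characters of the lattice *)

Section LatHom.
Variables (F : finFieldType) (m r : nat) (e : 'rV[int]_m) (w : 'I_m -> lattice r e).
Implicit Types gam : lat_hom F r e.

Lemma lat_hom_eq gam gam' : lat_hom_fun gam =1 lat_hom_fun gam' -> gam = gam'.
Proof.
case: gam gam' => f fD [g gD] /= /funext fg; subst g.
by congr LatHom; apply: Prop_irrelevance.
Qed.

Lemma lat_hom_sum gam (l : 'I_m -> int) :
  FinRing.uval (gam (\sum_i w i *~ l i)) =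
  \prod_i FinRing.uval (gam (w i)) ^ l i.
Proof.
pose f u := FinRing.uval (gam u).
have fD u u' : f (u + u') = f u * f u' by rewrite /f lat_homD.
have f0n u : f u != 0 by rewrite -unitfE /f; case: (gam u).
have f0 : f 0 = 1 by apply: (mulfI (f0n 0)); rewrite -fD addr0 mulr1.
have fMn u k : f (u *+ k) = f u ^+ k.
  by elim: k => [|k IHk]; rewrite ?mulr0n ?expr0 // mulrS exprS fD IHk.
have fN u : f (- u) = (f u)^-1.
  by apply: (mulfI (f0n u)); rewrite -fD subrr mulfV.
have fMz u k : f (u *~ k) = f u ^ k.
  by case: k => k; [apply: fMn | rewrite -[RHS]/((f u ^+ k.+1)^-1) -fMn -fN].
rewrite -/(f _) (big_morph f fD f0); apply: eq_bigr => i _; exact: fMz.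
Qed.

Hypothesis wP : Zbasis w.

Lemma lat_hom_basis_eq gam gam' :
  (forall i, FinRing.uval (gam (w i)) = FinRing.uval (gam' (w i))) -> gam = gam'.
Proof.
move=> eqw; have [crd [crdE _]] := Zbasis_coord wP.
apply: lat_hom_eq => u; apply: val_inj; rewrite (crdE u) /= !lat_hom_sum.
by apply: eq_bigr => i _; rewrite eqw.
Qed.

(** Coordinates in a basis are unique, hence additive, so [u |-> prod_i a_i^(u_i)] is a
    homomorphism. *)
Lemma lat_hom_exists (a : 'I_m -> F) : (forall i, a i != 0) ->
  exists gam, forall i, FinRing.uval (gam (w i)) = a i.
Proof.
move=> a0; have [crd [crdE crdU]] := Zbasis_coord wP.
pose f u := \prod_i a i ^ crd u i.
have fU u : f u \is a GRing.unit.
  by rewrite unitfE; apply/prodf_neq0 => i _; rewrite expfz_neq0.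
have crdD u u' i : crd (u + u') i = crd u i + crd u' i.
  apply: (crdU (u + u') (fun i => crd u i + crd u' i)).
  rewrite {1}(crdE u) {1}(crdE u') -big_split.
  by apply: eq_bigr => j _ /=; rewrite mulrzDr.
have fD u u' : FinRing.unit F (fU (u + u')) =
               (FinRing.unit F (fU u) * FinRing.unit F (fU u'))%g.
  apply: val_inj; rewrite /= /f -big_split; apply: eq_bigr => i _ /=.
  by rewrite crdD expfzDr.
exists (LatHom fD) => i /=; rewrite /f.
have crdw : crd (w i) =1 (fun j => (j == i)%:R).
  apply: crdU; rewrite (bigD1 i) //= eqxx mulr1z big1 ?addr0 // => j /negPf ->.
  by rewrite mulr0z.
rewrite (bigD1 i) //= crdw eqxx expr1z big1 ?mulr1 // => j /negPf ji.
by rewrite crdw ji expr0z.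
Qed.

End LatHom.

(** * Products of powers of the [B_j] and their denominators *)

Section ProductPolynomials.
Variables (Fn : fieldType) (Fnr : fieldExtType Fn) (m r : nat).
Variables (B : 'I_m -> {poly Fn}) (mu : 'I_m -> nat).
Hypothesis B_neq0 : forall j, B j != 0.
Hypothesis r_gt0 : (0 < r)%N.
Let P := \prod_j B j ^+ mu j.

Lemma size_prod_exp (k : 'I_m -> nat) :
  (size (\prod_j B j ^+ k j)).-1 = (\sum_j k j * (size (B j)).-1)%N.
Proof.
have nz (s : seq 'I_m) : \prod_(j <- s) B j ^+ k j != 0.
  by rewrite prodf_seq_neq0; apply/allP => j _; rewrite expf_neq0.
elim: (index_enum _) => [|j s IHs]; first by rewrite !big_nil size_poly1.
rewrite !big_cons size_mul ?nz ?expf_neq0 // -IHs mulnC -size_exp.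
move: (nz s) (expf_neq0 (k j) (B_neq0 j)); rewrite -!size_poly_eq0.
by case: (size _) (size _) => [|x] [|z] //= _ _; rewrite addnS.
Qed.

Lemma ext_poly_prod (k : 'I_m -> nat) :
  \prod_j ext_poly Fnr (B j) ^+ k j = ext_poly Fnr (\prod_j B j ^+ k j).
Proof. by rewrite /ext_poly rmorph_prod; apply: eq_bigr => j _; rewrite rmorphXn. Qed.

(* The largest common denominator whose r-th power divides P^i. *)
Definition denom (i : nat) : {poly Fnr} :=
  ext_poly Fnr (\prod_j B j ^+ ((i * mu j) %/ r)).

Lemma denom_neq0 i : denom i != 0.
Proof.
by rewrite map_poly_eq0; apply/prodf_neq0 => j _; rewrite expf_neq0.
Qed.

Lemma denom_dvd i : denom i ^+ r %| ext_poly Fnr P ^+ i.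
Proof.
rewrite /denom /ext_poly -!rmorphXn dvdp_map /P -!prodrXl.
apply: (big_ind2 (fun p q : {poly Fn} => p %| q)) => // [p q p' q'|j _].
  exact: dvdp_mul.
by rewrite -!exprM dvdp_exp2l // (mulnC (mu j)) leq_trunc_div.
Qed.

Lemma denom_horner i (y : Fn) : (forall j, (B j).[y] != 0) ->
  (denom i).[y%:A] != 0.
Proof.
move=> By0; rewrite /denom /ext_poly horner_map fmorph_eq0 horner_prod.
by apply/prodf_neq0 => j _; rewrite horner_exp expf_neq0.
Qed.

(** The numbers [l_j r + mu_j i] are [r] times the coordinates of [u = i v + sum_j l_j w_j] in the
    basis [w]. Their nonnegativity makes [denom i] clear all negative exponents [l_j]; the bound on
    their sum controls the degree of what is left. *)
Lemma monom_numerator (Q C : nat) (i : nat) (a : Fnr) (l : 'I_m -> int) :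
  (forall j, ((size (B j)).-1 <= Q)%N) ->
  (forall j, 0 <= l j *+ r + (mu j)%:Z *+ i) ->
  \sum_j (l j *+ r + (mu j)%:Z *+ i) <= (r * C)%:Z ->
  exists U : {poly Fnr},
  [/\ a%:P%:F * \prod_j (ext_poly Fnr (B j))%:F ^ l j = U%:F / (denom i)%:F,
      U != 0 -> (r * (size U).-1 + i * (size P).-1
                 <= Q * r * C + r * (size (denom i)).-1)%N &
      forall y, (forall j, (B j).[y] != 0) ->
        U.[y%:A] / (denom i).[y%:A] = a * \prod_j ((B j).[y]%:A) ^ l j].
Proof.
move=> szB l_ge0 l_le; pose k j := ((i * mu j) %/ r)%N.
(* As [k_j] is a floor, [(k_j + 1) r > i mu_j]; hence [(l_j + k_j + 1) r > l_j r + i mu_j >= 0]. *)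
have lk_ge0 j : 0 <= l j + (k j)%:Z.
  have : 0 < (l j + (k j)%:Z + 1) * r%:Z.
    apply: le_lt_trans (l_ge0 j) _.
    rewrite -addrA mulrDl -[l j *+ r]mulr_natr -[_ *+ i]mulr_natr !natz -PoszM.
    rewrite ltrD2l -[1]/(1%:Z) -PoszD -PoszM ltz_nat addn1 mulnC.
    exact: ltn_ceil.
  by rewrite pmulr_lgt0 ?ltz_nat // ltzD1.
pose lk j := absz (l j + (k j)%:Z).
have lkE j : (lk j)%:Z = l j + (k j)%:Z by rewrite gez0_abs.
have prodE (K : fieldType) (x : 'I_m -> K) : (forall j, x j != 0) ->
    (\prod_j x j ^+ lk j) / \prod_j x j ^+ k j = \prod_j x j ^ l j.
  move=> x0; rewrite -prodf_div; apply: eq_bigr => j _.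
  rewrite -[_ ^+ lk j]/(x j ^ (lk j)%:Z) lkE expfzDr // -mulrA.
  by rewrite -[X in _ * (X * _)]/(x j ^+ k j) mulfV ?mulr1 // expf_neq0.
exists (a%:P * ext_poly Fnr (\prod_j B j ^+ lk j)); split.
- rewrite tofracM -mulrA -prodE => [|j]; last first.
    by rewrite tofrac_neq0 map_poly_eq0.
  rewrite /denom -!ext_poly_prod !rmorph_prod.
  by congr (_ * (_ / _)); apply: eq_bigr => j _; rewrite rmorphXn.
- rewrite mulf_eq0 negb_or polyC_eq0 => /andP[a0 _].
  rewrite mul_polyC size_scale // !size_map_poly !size_prod_exp.
  pose A j := absz (l j *+ r + (mu j)%:Z *+ i).
  have AE j : (A j)%:Z = l j *+ r + (mu j)%:Z *+ i by rewrite gez0_abs.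
  have A_le : (\sum_j A j <= r * C)%N.
    by rewrite -lez_nat -natz natr_sum; under eq_bigr do rewrite natz AE.
  (* Weighted by [deg B_j] and summed, this identity isolates the excess over [r deg (denom i)] as
     [sum_j A_j deg B_j], which is at most [Q r C]. *)
  have step j : (r * lk j + i * mu j = A j + r * k j)%N.
    apply/eqP; rewrite -eqz_nat !PoszD !PoszM lkE AE.
    rewrite mulrDr addrAC -[l j *+ r]mulr_natr -[_ *+ i]mulr_natr !natz.
    by rewrite ![_ * r%:Z]mulrC ![_ * i%:Z]mulrC.
  rewrite !big_distrr /= -!big_split /=.
  under eq_bigr do rewrite !mulnA -mulnDl step mulnDl -mulnA.
  rewrite big_split leq_add2r /= -mulnA mulnC.
  apply: leq_trans (_ : (\sum_j A j * Q <= _)%N).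
    by apply: leq_sum => j _; rewrite leq_mul2l szB orbT.
  by rewrite -big_distrl leq_mul2r A_le orbT.
- move=> y By0; rewrite hornerM hornerC -mulrA -prodE => [|j]; last first.
    by rewrite scaler_eq0 oner_eq0 orbF.
  rewrite /denom -!ext_poly_prod !horner_prod.
  congr (_ * (_ / _)); apply: eq_bigr => j _;
    by rewrite horner_exp /ext_poly horner_map.
Qed.

End ProductPolynomials.

(** * The polynomials [B_j] on [E], and the polynomial [P] *)

Section DualPoints.
Variables (F : finFieldType) (Fn : splittingFieldType F) (m n : nat).
Variables (b : n.-tuple Fn) (B : 'I_m -> {poly Fn}) (mu : 'I_m -> int).
Variable P : {poly Fn}.
Hypothesis b_basis : basis_of {:Fn} b.
Hypothesis dimFn : \dim {:Fn} = n.
Hypothesis le_mn : (m <= n)%N.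
Hypothesis B_beta : forall i y, Eset m b y -> (B i).[y] = beta b i y.
Hypothesis PE : P%:F = \prod_i ((B i)%:F ^ mu i).

Lemma Eset_point (t : 'I_m -> F) :
  exists2 y, Eset m b y & forall j : 'I_m, beta b j y = (t j)%:A.
Proof.
(* Targets from index [m] on are set to 0, which places the point in [E]. *)
pose t' j := oapp t 0 (insub j).
have [y yE] := beta_surj b_basis dimFn t'.
exists y => [j /andP[mj jn]|j].
  by rewrite yE // /t' insubF ?scale0r // ltnNge mj.
by rewrite yE ?(leq_trans (ltn_ord j)) // /t' valK.
Qed.

Lemma B_neq0 j : B j != 0.
Proof.
have [y yE yt] := Eset_point (fun=> 1).
by apply: contra_eq_neq (B_beta j yE) => ->; rewrite horner0 yt scale1r eq_sym oner_eq0.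
Qed.

(* B_j vanishes at a point of E where no other B_k does, and P is a polynomial. *)
Lemma mu_ge0 j : 0 <= mu j.
Proof.
rewrite leNgt; apply/negP => muj.
have [y yE yt] := Eset_point (fun k => (k != j)%:R).
(* Sorting the factors by the sign of [mu_k] turns the identity of fractions into [P * den = num]
   between polynomials. At [y] the factor [B_j] makes [den] vanish, while [num] does not. *)
pose num := \prod_(k < m) if 0 <= mu k then B k ^+ absz (mu k) else 1.
pose den := \prod_(k < m) if 0 <= mu k then 1 else B k ^+ absz (mu k).
have PdenE : P * den = num.
  apply/eqP; rewrite -tofrac_eq tofracM PE !rmorph_prod -big_split /=.
  apply/eqP/eq_bigr => k _; case: (ltrP (mu k) 0) => [muk|muk].
    rewrite -{1}[mu k]opprK -(ltz0_abs muk) -exprnN rmorphXn mulVf ?tofrac1 //.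
    by rewrite expf_neq0 ?tofrac_neq0 ?B_neq0.
  by rewrite tofrac1 mulr1 rmorphXn -{1}(gez0_abs muk).
have By k : (B k).[y] = (k != j)%:R by rewrite B_beta // yt scaler_nat.
have : num.[y] != 0.
  rewrite horner_prod; apply/prodf_neq0 => k _; case: ifP => [muk|_]; last first.
    by rewrite hornerC oner_eq0.
  rewrite horner_exp By expf_neq0 //; case: (eqVneq k j) muk => [->|_ _].
    by rewrite leNgt muj.
  exact: oner_neq0.
rewrite -PdenE hornerM horner_prod (bigD1 j) //= leNgt muj /= horner_exp By eqxx.
by rewrite expr0n absz_eq0 (lt_eqF muj) mul0r mulr0 eqxx.
Qed.

Lemma P_prod : P = \prod_i B i ^+ absz (mu i).
Proof.
apply/eqP; rewrite -tofrac_eq PE rmorph_prod; apply/eqP/eq_bigr => i _.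
by rewrite rmorphXn -{1}(gez0_abs (mu_ge0 i)).
Qed.

Lemma Iset_horner y : Iset m b y -> forall j, (B j).[y] = beta b j y /\ (B j).[y] != 0.
Proof. by move=> [yE y0] j; rewrite B_beta ?y0. Qed.

End DualPoints.

(** * Simplex points and their coordinates *)

Section SimplexCoordinates.
Variables (R : realType) (m r : nat) (e : 'rV[int]_m) (w : 'I_m -> lattice r e).
Variables (v : 'rV[int]_m) (mu : 'I_m -> int) (c : nat).
Hypothesis r_gt0 : (0 < r)%N.
Hypothesis wP : Zbasis w.
Hypothesis ev1 : (dotz e v = 1 %[mod r%:Z])%Z.
Hypothesis rvE : v *+ r = \sum_i lat_val (w i) *~ mu i.

(** In the basis [w], the vector [r u] has integer coordinates [l_j r + mu_j i], and real
    coordinates [r lam_j] by membership in the simplex; [Zbasis_free] identifies the two. *)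
Lemma simplex_coord_bounds u (i : nat) (l : 'I_m -> int) :
  simplex R w c u -> u = v *+ i + \sum_j lat_val (w j) *~ l j ->
  (forall j, 0 <= l j *+ r + mu j *+ i) /\
  \sum_j (l j *+ r + mu j *+ i) <= (r * c)%:Z.
Proof.
move=> [lam [lam_ge0 lam_le lamE]] uE.
pose z j : int := l j *+ r + mu j *+ i.
have uzE : u *+ r = \sum_j lat_val (w j) *~ z j.
  rewrite uE mulrnDl -mulrnA mulnC mulrnA rvE addrC -!sumrMnl -big_split /=.
  by apply: eq_bigr => j _; rewrite mulrzDr !pmulrn -!mulrzA !mulrzz.
have zE j : (z j)%:~R = lam j * r%:R.
  apply/eqP; rewrite -subr_eq0; apply/eqP; move: j.
  apply: (Zbasis_free wP r_gt0 (R := R)).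
  under eq_bigr do rewrite scalerBl; rewrite sumrB.
  apply/eqP; rewrite subr_eq0; apply/eqP.
  transitivity (map_mx (intr : int -> R) (u *+ r)).
    rewrite uzE raddf_sum; apply: eq_bigr => j _ /=.
    by rewrite raddfMz scaler_int.
  rewrite raddfMn /= lamE -sumrMnl; apply: eq_bigr => j _.
  by rewrite scalerMnl mulr_natr.
split=> [j|]; first by rewrite -(ler0z R) zE mulr_ge0 ?ler0n.
rewrite -(ler_int R) rmorph_sum /=; under eq_bigr do rewrite zE.
by rewrite -mulr_suml mulnC PoszM rmorphM /= ler_wpM2r ?ler0n.
Qed.

(** Since [e.v = 1] modulo [r], taking for [i] the residue of [e.u] puts [u - i v] in the
    lattice. *)
Lemma lattice_decomp u : exists (i : 'I_r) (l : 'I_m -> int),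
  u = v *+ i + \sum_j lat_val (w j) *~ l j.
Proof.
have rz : r%:Z != 0 by rewrite eqz_nat gtn_eqF.
have ir : (absz (dotz e u %% r%:Z)%Z < r)%N.
  by rewrite -ltz_nat gez0_abs ?modz_ge0 // ltz_pmod.
pose i := Ordinal ir; have iE : i%:Z = (dotz e u %% r%:Z)%Z by rewrite gez0_abs ?modz_ge0.
have uL : u - v *+ i \in in_lat r e.
  rewrite inE dotzB dotzMn -mulr_natr natz iE.
  rewrite -eqz_mod_dvd; apply/eqP.
  by rewrite -modzMml ev1 modzMml mul1r modz_mod.
have [crd [crdE _]] := Zbasis_coord wP.
exists i, (crd (Lattice uL)); rewrite -lat_val_sum -crdE /=.
by rewrite addrC subrK.
Qed.

Lemma dotz_decomp (i : 'I_r) (l : 'I_m -> int) :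
  (dotz e (v *+ i + \sum_j lat_val (w j) *~ l j) %% r%:Z)%Z = i%:Z.
Proof.
rewrite dotzD -lat_val_sum -modzDmr.
have /dvdz_mod0P -> := lattice_dvd (\sum_j w j *~ l j).
rewrite addr0 dotzMn -mulr_natr natz -modzMml ev1 modzMml mul1r.
by rewrite modz_small // ltz_nat ltn_ord.
Qed.

End SimplexCoordinates.

(** * Comparison of the two codes at one point *)

Section LocalComparison.
Variables (F : finFieldType) (m r : nat).
Variables (Fr : fieldExtType F) (Fn : splittingFieldType F) (Fnr : fieldExtType Fn).
Variable iota : {rmorphism Fr -> Fnr}.
Hypothesis iotaF : forall a : F, iota a%:A = (a%:A : Fn)%:A.
Variable theta : 'AEnd(Fnr).
Hypothesis thetaP : forall x, theta (iota x) = iota (x ^+ #|F|).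
Hypothesis r_gt0 : (0 < r)%N.
Hypothesis dimFr : \dim {:Fr} = r.
Variables (e : 'rV[int]_m) (w : 'I_m -> lattice r e) (v : 'rV[int]_m).
Hypothesis ev1 : (dotz e v = 1 %[mod r%:Z])%Z.

Lemma expf_card_mod k (x : Fr) : x ^+ (#|F| ^ (k %% r)) = x ^+ (#|F| ^ k).
Proof.
rewrite [in RHS](divn_eq k r) expnD exprM; congr (_ ^+ _).
elim: (k %/ r)%N => [|d IHd]; first by rewrite mul0n expr1.
rewrite mulSn expnD exprM; have := memvf x.
by rewrite (Fermat's_little_theorem {:Fr}%AS) dimFr => /eqP ->.
Qed.

Lemma Frob_dotz (i : nat) (x : Fr) : Frob r (dotz e (v *+ i)) x = x ^+ (#|F| ^ i).
Proof.
rewrite /Frob dotzMn -mulr_natr natz -modzMml ev1 modzMml mul1r modz_nat /=.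
exact: expf_card_mod.
Qed.

Lemma eval_laurentE (tg : 'rV[int]_m -> Fr) (f : laurent Fr m) x :
  eval_laurent r e tg f x =
  \sum_(u <- finsupp f) f u * tg u * Frob r (dotz e u) x.
Proof.
rewrite /eval_laurent linfunE // => a y z.
rewrite scaler_sumr -big_split; apply: eq_bigr => u _ /=.
by rewrite /Frob (frob_linear iotaF thetaP) mulrDr scalerAr.
Qed.

Lemma eval_laurent_monom (tg : 'rV[int]_m -> Fr) a u x :
  eval_laurent r e tg (laurent_monom a u) x = a * tg u * Frob r (dotz e u) x.
Proof.
rewrite eval_laurentE /laurent_monom.
(* For [a = 0] the support is empty, so in general it is only included in the singleton. *)
rewrite (@big_fset_incl _ _ _ _ _ [fset u]%fset).
- by rewrite big_seq_fset1 fsfunE inE eqxx.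
- apply/fsubsetP => z; rewrite mem_finsupp fsfunE.
  by case: ifP => // _; rewrite eqxx.
- by move=> z _; rewrite memNfinsupp => /eqP ->; rewrite !mul0r.
Qed.

(** The extension to [Fnr] of the evaluation of [a X^u], with [theta] in place of the Frobenius
    map. *)
Definition monom_lfun (tg : 'rV[int]_m -> Fr) (a : Fr) (u : 'rV[int]_m) : 'End(Fnr) :=
  linfun (fun x => iota (a * tg u) * iter (absz (dotz e u %% r%:Z)%Z) theta x).

Lemma monom_lfunE tg a u x :
  monom_lfun tg a u x = iota (a * tg u) * iter (absz (dotz e u %% r%:Z)%Z) theta x.
Proof.
rewrite /monom_lfun linfunE // => k y z.
by rewrite iter_theta_linear mulrDr scalerAr.
Qed.

Lemma extends_monom tg a u x :
  monom_lfun tg a u (iota x) = iota (a * tg u * Frob r (dotz e u) x).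
Proof. by rewrite monom_lfunE (iter_theta_iota thetaP) -rmorphM. Qed.

Section TwistedCharacter.
Variables (gam : lat_hom F r e) (tg : 'rV[int]_m -> Fr).
Hypothesis tgP : twisted_ext gam tg.

Lemma twisted_ext_lattice (l : 'I_m -> int) :
  tg (\sum_j lat_val (w j) *~ l j) = (\prod_j FinRing.uval (gam (w j)) ^ l j)%:A.
Proof. by case: tgP => _ tgL _; rewrite -lat_val_sum tgL lat_hom_sum. Qed.

(** The Frobenius twist disappears because the values of the character lie in [F]; this is checked
    in [Fnr], where [theta] fixes [Fn]. *)
Lemma twisted_ext_decomp i (l : 'I_m -> int) :
  tg (v *+ i + \sum_j lat_val (w j) *~ l j) =
  tg (v *+ i) * (\prod_j FinRing.uval (gam (w j)) ^ l j)%:A.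
Proof.
case: (tgP) => _ _ ->; rewrite twisted_ext_lattice Frob_dotz; congr (_ * _).
apply: (fmorph_inj iota); rewrite -(iter_theta_iota thetaP) iotaF.
exact: iter_thetaA.
Qed.

Variables (B : 'I_m -> {poly Fn}) (mu : 'I_m -> nat) (y : Fn).
Variable eta : DP Fnr r -> 'End(Fnr).
Let P := \prod_j B j ^+ mu j.
Hypothesis rvE : v *+ r = \sum_i lat_val (w i) *~ (mu i)%:Z.
Hypothesis B_neq0 : forall j, B j != 0.
Hypothesis gamB : forall j, (FinRing.uval (gam (w j)))%:A = (B j).[y].
Hypothesis By_neq0 : forall j, (B j).[y] != 0.
Hypothesis etaP : quotient_map theta P y eta.

Lemma iota_prod (l : 'I_m -> int) :
  iota (\prod_j FinRing.uval (gam (w j)) ^ l j)%:A = \prod_j ((B j).[y]%:A) ^ l j.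
Proof.
rewrite iotaF -[_%:A in LHS]/(in_alg Fnr (in_alg Fn _)) !rmorph_prod.
by apply: eq_bigr => j _; rewrite !fmorphXz /= gamB.
Qed.

(** The map [S] is fixed before [a], [i] and [l], so one conjugation handles all monomials at the
    point. The numerator [U] stays a parameter, to be supplied by [monom_numerator]. *)
Lemma local_intertwiner : exists2 S : 'End(Fnr), lker S == 0%VS &
  forall (a : Fr) (i : 'I_r) (l : 'I_m -> int) (U : {poly Fnr}),
    (iota a)%:P%:F * \prod_j (ext_poly Fnr (B j))%:F ^ l j =
      U%:F / (denom Fnr r B mu i)%:F ->
    U.[y%:A] / (denom Fnr r B mu i).[y%:A] =
      iota a * \prod_j ((B j).[y]%:A) ^ l j ->
    (eta (DP_monom i ((iota a)%:P%:F * \prod_j (ext_poly Fnr (B j))%:F ^ l j))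
       \o S)%VF =
    (S \o monom_lfun tg a (v *+ i + \sum_j lat_val (w j) *~ l j))%VF.
Proof.
(* With this choice the twisted law of [tg] becomes [cD]. *)
pose c k := (iota (tg (v *+ k)))^-1.
have [tg0 _ tgD] := tgP.
have c0 k : c k != 0 by rewrite invr_eq0 fmorph_eq0.
have cD i j : c (i + j)%N = c i * iter i theta (c j).
  rewrite /c -!fmorphV (iter_theta_iota thetaP) -rmorphM mulrnDr tgD.
  by rewrite Frob_dotz invfM exprVn.
(* The vector [r v] lies in the lattice, where [tg] is given by the character; its value there is
   [prod_j B_j(y)^(mu_j) = P(y)]. *)
have cr : c r * P.[y]%:A = 1.
  have -> : P.[y]%:A = iota (tg (v *+ r)).
    rewrite rvE twisted_ext_lattice iota_prod /P horner_prod.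
    rewrite -[_%:A in LHS]/(in_alg Fnr _) rmorph_prod.
    by apply: eq_bigr => j _; rewrite horner_exp rmorphXn.
  by rewrite /c mulVf // fmorph_eq0.
have Vdvd (i : 'I_r) : denom Fnr r B mu i ^+ r %| ext_poly Fnr P ^+ i.
  exact: denom_dvd.
have [S S0 SE] := intertwiner (fun i : 'I_r => denom_neq0 Fnr r mu B_neq0 i) Vdvd
  etaP (fun i : 'I_r => denom_horner Fnr r mu i By_neq0) r_gt0 c0 cD cr.
exists S => // a i l U sE UyE; apply/lfunP => x.
rewrite !comp_lfunE sE SE UyE monom_lfunE (dotz_decomp w ev1) /=.
congr (S (_ * _)); rewrite twisted_ext_decomp !rmorphM /= iota_prod /c invrK.
by rewrite -!mulrA [X in _ * X]mulrC.
Qed.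

End TwistedCharacter.
End LocalComparison.

(** * Conjugation by an injective endomorphism *)

Section Conjugation.
Variables (K : fieldType) (V : vectType K) (S : 'End(V)).
Hypothesis S0 : lker S == 0%VS.

Definition conj_lfun (X : 'End(V)) : 'End(V) := (S \o X \o S^-1)%VF.

Lemma conj_lfun_linear : linear conj_lfun.
Proof.
move=> a X Y; rewrite /conj_lfun comp_lfunDr comp_lfunDl.
by rewrite -comp_lfunZr -comp_lfunZl.
Qed.

Lemma dim_conj_lfun X : \dim (limg (conj_lfun X)) = \dim (limg X).
Proof.
rewrite /conj_lfun !limg_comp.
have -> : limg (S^-1)%VF = fullv.
  apply/vspaceP => x; rewrite memvf; apply/memv_imgP; exists (S x); rewrite ?memvf //.
  by rewrite lker0_lfunK.
by rewrite limg_dim_eq // (eqP S0) capv0.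
Qed.

Lemma conj_lfun_eq (X Y : 'End(V)) : (Y \o S)%VF = (S \o X)%VF -> conj_lfun X = Y.
Proof. by move=> YS; rewrite /conj_lfun -YS lker0_compfK. Qed.

Lemma conj_lfun_inj : injective conj_lfun.
Proof.
move=> X Y /(congr1 (fun Z => S^-1 \o (Z \o S)))%VF.
by rewrite /conj_lfun !lker0_compfVK // !lker0_compKf.
Qed.

End Conjugation.

(** * Base-changed codes as subspaces *)

Lemma subspace_base_change (F : finFieldType) (Fr : fieldExtType F)
  (Fn : splittingFieldType F) (Fnr : fieldExtType Fn) (iota : Fr -> Fnr)
  (J : Type) (C : set (J -> 'End(Fr))) : subspace (base_change iota C).
Proof.
split.
  exists 0%N, (fun=> 0), (fun=> 0), (fun=> 0); split=> [[]|[]|] //.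
  by rewrite big_ord0.
move=> c _ _ [k1 [a1 [f1 [g1 [C1 ext1 ->]]]]] [k2 [a2 [f2 [g2 [C2 ext2 ->]]]]].
(* Two combinations are concatenated, the scalar being absorbed into the coefficients of the
   first. *)
pose glue T (h1 : 'I_k1 -> T) (h2 : 'I_k2 -> T) i :=
  match fintype.split i with inl j => h1 j | inr j => h2 j end.
exists (k1 + k2)%N, (glue _ (fun j => c * a1 j) a2), (glue _ f1 f2), (glue _ g1 g2).
split=> [i|i j|].
- by rewrite /glue; case: (fintype.split i).
- by rewrite /glue; case: (fintype.split i).
rewrite scaler_sumr big_split_ord /=; congr (_ + _); apply: eq_bigr => i _.
  by rewrite /glue (unsplitK (inl _ i)) scalerA.
by rewrite /glue (unsplitK (inr _ i)).
Qed.

(** * The isomorphism of codes *)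

Theorem theorem4p10
  (F : finFieldType) (m r n c : nat)
  (Fr : fieldExtType F) (Fn : splittingFieldType F) (Fnr : fieldExtType Fn)
  (m_gt0 : (0 < m)%N) (r_gt0 : (0 < r)%N) (c_gt0 : (0 < c)%N)
  (le_mn : (m <= n)%N) (co_nr : coprime n r)
  (dimFr : \dim {:Fr} = r) (dimFn : \dim {:Fn} = n) (dimFnr : \dim {:Fnr} = r)
  (iota : {rmorphism Fr -> Fnr})
  (iotaF : forall a : F, iota a%:A = (a%:A : Fn)%:A)
  (* the LRM side *)
  (e : 'rV[int]_m)
  (gcd_er : gcdn (\big[gcdn/0%N]_(i < m) `|e 0%R i|%N) r = 1%N)
  (w : 'I_m -> lattice r e) (wP : Zbasis w)
  (R : realType)
  (tgam : lat_hom F r e -> 'rV[int]_m -> Fr)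
  (tgamP : forall gam, twisted_ext gam (tgam gam))
  (* the auxiliary data *)
  (b : n.-tuple Fn) (b_basis : basis_of {:Fn} b)
  (B : 'I_m -> {poly Fn})
  (B_size : forall i, (size (B i) <= (#|F| ^ m.-1).+1)%N)
  (B_beta : forall i y, Eset m b y -> (B i).[y] = beta b i y)
  (v : 'rV[int]_m) (ev1 : (dotz e v = 1 %[mod r%:Z])%Z)
  (mu : 'I_m -> int) (rvE : v *+ r = \sum_i lat_val (w i) *~ mu i)
  (P : {poly Fn}) (PE : P%:F = \prod_i ((B i)%:F ^ mu i))
  (* the LAG side *)
  (theta : 'AEnd(Fnr)) (thetaP : forall x, theta (iota x) = iota (x ^+ #|F|))
  (eta : Fn -> DP Fnr r -> 'End(Fnr))
  (etaP : forall y, Iset m b y -> quotient_map theta P y (eta y)) :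
  let code := base_change iota (LRM tgam (simplex R w c)) in
  exists (D : set (Iset m b -> 'End(Fnr)))
         (psi : (lat_hom F r e -> 'End(Fnr)) -> (Iset m b -> 'End(Fnr))),
  [/\ subspace D /\ D `<=` LAG P (#|F| ^ m.-1 * r * c) (I := Iset m b) eta,
      set_bij code D psi,
      linear_on code psi,
      (forall f g, code f -> code g ->
         sumrank_dist (psi f) (psi g) = sumrank_dist f g) &
      (* psi is induced by X^(w_j) |-> B_j(Y), X^v |-> T *)
      (forall (a : Fr) (i : 'I_r) (l : 'I_m -> int) (u : 'rV[int]_m)
              (f : lat_hom F r e -> 'End(Fnr)),
         simplex R w c u ->
         u = v *+ i + \sum_j lat_val (w j) *~ l j ->
         (forall gam, extends iota
            (eval_laurent r e (tgam gam) (laurent_monom a u)) (f gam)) ->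
         psi f = (fun y : Iset m b => eta (\val y)
           (DP_monom i ((iota a)%:P%:F * \prod_j ((ext_poly Fnr (B j))%:F ^ l j)))))].
Proof.
move=> code.
pose I := Iset m b; pose mun j := absz (mu j).
have muE j : mu j = (mun j)%:Z.
  by rewrite gez0_abs // (mu_ge0 b_basis dimFn le_mn B_beta PE).
have B0 := B_neq0 b_basis dimFn le_mn B_beta.
have PE' : P = \prod_j B j ^+ mun j := P_prod b_basis dimFn le_mn B_beta PE.
have rvE' : v *+ r = \sum_i lat_val (w i) *~ (mun i)%:Z.
  by rewrite rvE; apply: eq_bigr => i _; rewrite muE.
have [bF bFE] := betaP b.
pose mon (a : Fr) (i : 'I_r) (l : 'I_m -> int) : DP Fnr r :=
  DP_monom i ((iota a)%:P%:F * \prod_j (ext_poly Fnr (B j))%:F ^ l j).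
pose lat (i : nat) (l : 'I_m -> int) := v *+ i + \sum_j lat_val (w j) *~ l j.
have szB j : ((size (B j)).-1 <= #|F| ^ m.-1)%N.
  by have := B_size j; case: (size _).
(* Character and intertwiner form one pair, so that a single choice over [y] yields both. *)
have local (y : I) : exists p : lat_hom F r e * 'End(Fnr),
  [/\ forall j, (FinRing.uval (p.1 (w j)))%:A = beta b j (\val y),
      lker p.2 == 0%VS &
      forall a (i : 'I_r) l, simplex R w c (lat i l) ->
        conj_lfun p.2 (monom_lfun r iota theta e (tgam p.1) a (lat i l)) =
        eta (\val y) (mon a i l)].
  have yI : I (\val y) := set_valP y.
  have Iy := Iset_horner B_beta yI.
  have By0 j : (B j).[val y] != 0 by have [_] := Iy j.
  have [j|gam gamE] := lat_hom_exists wP (a := fun j => bF j (\val y)).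
    by apply: contra_neq (By0 j) => bF0; have [-> _] := Iy j; rewrite bFE bF0 scale0r.
  have gamB j : (FinRing.uval (gam (w j)))%:A = (B j).[val y].
    by have [-> _] := Iy j; rewrite gamE bFE.
  have etaP' := etaP _ yI; rewrite PE' in etaP'.
  have [S S0 SE] := local_intertwiner iotaF thetaP r_gt0 dimFr ev1 (tgamP gam)
    rvE' B0 gamB By0 etaP'.
  exists (gam, S); split=> //= [j|a i l sim]; first by rewrite gamE bFE.
  apply: conj_lfun_eq => //.
  have [l_ge0 l_le] := simplex_coord_bounds r_gt0 wP rvE' sim erefl.
  have [U [sE _ /(_ _ By0) UyE]] := monom_numerator B0 r_gt0 (iota a) szB l_ge0 l_le.
  exact: SE sE UyE.
have [p pP] := choice local.
pose h y := (p y).1; pose S y := (p y).2.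
have hB y j : (FinRing.uval (h y (w j)))%:A = beta b j (val y) by have [] := pP y.
have S0 y : lker (S y) == 0%VS by have [] := pP y.
(* A character is determined by its values on [w], and a point of [I] by its first [m] trace forms,
   the others vanishing on [E]. The types [{classic _}] are those over which [sumrank_weight]
   sums. *)
have hbij : bijective (h : {classic I} -> {classic lat_hom F r e}).
  rewrite -setTT_bijective; split=> [//|y y' _ _ hyy'|gam _].
    apply: val_inj; apply/eqP; rewrite -subr_eq0; apply/eqP.
    apply: (beta_eq0 b_basis) => j jn; rewrite -scaleN1r addrC beta_linear scaleN1r.
    have [yE _] := set_valP y; have [y'E _] := set_valP y'.
    have [jm|mj] := ltnP j m; last by rewrite yE ?mj // y'E ?mj // oppr0 addr0.
    by rewrite -(hB y (Ordinal jm)) -(hB y' (Ordinal jm)) hyy' addNr.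
  have [y yE yt] := Eset_point b_basis dimFn le_mn (fun j => FinRing.uval (gam (w j))).
  have yI : I y.
    split=> // j jm; rewrite (yt (Ordinal jm)) scaler_eq0 oner_eq0 orbF -unitfE.
    by case: (gam _).
  exists (SigSub (mem_set yI)) => //; apply: (lat_hom_basis_eq wP) => j.
  by apply: (fmorph_inj (in_alg Fn)); rewrite /= hB yt.
(* Conjugation is applied blockwise to all tuples, so linearity and injectivity hold beyond the code
   itself. *)
pose psi (f : lat_hom F r e -> 'End(Fnr)) : I -> 'End(Fnr) :=
  fun y => conj_lfun (S y) (f (h y)).
have psi_lin k f g : psi (k *: f + g) = k *: psi f + psi g.
  by apply: funext => y; rewrite /psi conj_lfun_linear.
have psi0 : psi 0 = 0.
  by apply: funext => y; rewrite /psi /conj_lfun comp_lfun0r comp_lfun0l.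
have psi_inj : injective psi.
  move=> f g fg; apply: funext => gam; have [h' _ hK] := hbij.
  by rewrite -(hK gam); apply: (conj_lfun_inj (S0 _)); apply: (congr1 (@^~ (h' gam)) fg).
have ext_eq gam a u (f : 'End(Fnr)) :
    extends iota (eval_laurent r e (tgam gam) (laurent_monom a u)) f ->
    f = monom_lfun r iota theta e (tgam gam) a u.
  move=> fE; apply: (lfun_iota_eq iotaF thetaP); first by rewrite dimFr.
  move=> x; rewrite fE (eval_laurent_monom r iotaF thetaP).
  by rewrite (extends_monom _ thetaP).
pose V (i : 'I_r) := denom Fnr r B mun i.
have V0 i : V i != 0 by apply: denom_neq0.
have Vd i : V i ^+ r %| ext_poly Fnr P ^+ i by rewrite PE'; apply: denom_dvd.
have Vy (y : I) i : (V i).[(val y)%:A] != 0.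
  by apply: denom_horner => j; have [] := Iset_horner B_beta (set_valP y) j.
pose N := (#|F| ^ m.-1 * r * c)%N.
(* One [d] must serve all points [y] at once. The property is closed under [Fn]-linear combinations,
   so for codewords it suffices to treat monomials. *)
pose lifted f := exists d, bounded_num P V N d /\ forall y : I, psi f y = eta (val y) d.
have lifted0 : lifted 0.
  exists 0; split; first exact: bounded_num0.
  by move=> y; rewrite psi0 (eta0 V0 Vd (etaP _ (set_valP y))).
have lifted_lin k f g : lifted f -> lifted g -> lifted (k *: f + g).
  move=> [d [dN dE]] [d' [d'N d'E]].
  have kdN : bounded_num P V N (DP_scale (k%:A)%:P%:F d) by apply: bounded_numZ.
  exists (DP_scale (k%:A)%:P%:F d + d'); split; first exact: bounded_numD.
  move=> y; have etay := etaP _ (set_valP y).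
  rewrite psi_lin (etaD V0 Vd etay); [|by exists N|by exists N].
  by rewrite (etaZ V0 Vd etay) -?dE -?d'E //; exists N.
have liftedD f g : lifted f -> lifted g -> lifted (f + g).
  by have := lifted_lin 1 f g; rewrite scale1r.
have lifted_monom a u : simplex R w c u ->
    lifted (fun gam => monom_lfun r iota theta e (tgam gam) a u).
  have [i [l uE]] := lattice_decomp r_gt0 wP ev1 u; rewrite uE => sim.
  exists (mon a i l); split; last by move=> y; have [_ _ pE] := pP y; apply: pE.
  have [l_ge0 l_le] := simplex_coord_bounds r_gt0 wP rvE' sim erefl.
  have [U [sE Ule _]] := monom_numerator B0 r_gt0 (iota a) szB l_ge0 l_le.
  by rewrite /mon sE; apply: bounded_num_monom; rewrite PE'.
have code_lifted f : code f -> lifted f.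
  move=> [k [a [f' [g [f'C ext ->]]]]].
  apply: (big_ind lifted) => // i _.
  have := lifted_lin (a i) (g i) 0; rewrite addr0; apply=> //.
  have [phi [phiS f'E]] := f'C i.
  (* Both sides extend the same endomorphisms of [Fr], hence agree. *)
  have -> : g i = \sum_(u <- finsupp phi)
      (fun gam => monom_lfun r iota theta e (tgam gam) (phi u) u).
    apply: funext => gam; rewrite fct_sumE.
    apply: (lfun_iota_eq iotaF thetaP); first by rewrite dimFr.
    move=> x; rewrite ext f'E (eval_laurentE r iotaF thetaP) rmorph_sum sum_lfunE.
    by apply: eq_bigr => u _; rewrite (extends_monom _ thetaP).
  rewrite big_seq; apply: (big_ind lifted) => // u uphi.
  by apply: lifted_monom; apply: phiS; rewrite -mem_finsupp.
exists (psi @` code), psi; split.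
- split.
    have [code0 codeL] := subspace_base_change iota (LRM tgam (simplex R w c)).
    split; first by exists 0.
    by move=> k _ _ [f fC <-] [g gC <-]; exists (k *: f + g); [apply: codeL|].
  move=> _ [f fC <-]; have [d [dN dE]] := code_lifted f fC.
  exists d; last exact: funext.
  exact: (bounded_num_Lambda V0 Vd dN).
- split=> [f fC|f g _ _|_ [f fC <-]]; [by exists f|exact: psi_inj|by exists f].
- by move=> k f g _ _; apply: psi_lin.
- move=> f g _ _; rewrite /sumrank_dist /sumrank_weight.
  (* The bijection [h] matches the blocks, and conjugation preserves the rank of each. *)
  rewrite [RHS](@reindex_fsbigT _ _ _ {classic I} {classic lat_hom F r e} h) //.
  apply: eq_fsbigr => y _.
  have -> : (psi f - psi g) y = conj_lfun (S y) ((f - g) (h y)).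
    by rewrite -[RHS]/(psi (f - g) y) addrC -scaleN1r -psi_lin scaleN1r addrC.
  exact: dim_conj_lfun.
(* Extensions being unique, each [f gam] is a [monom_lfun], whose conjugate at [y] is known from
   [pP]. *)
- move=> a i l u f sim uE fE; apply: funext => y; rewrite /psi.
  have [_ _ pE] := pP y; rewrite (ext_eq _ _ _ _ (fE (h y))) uE pE //.
  by rewrite /lat -uE.
Qed.
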